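(* Let $f:[0,1]\to\mathbb{R}$ be continuous. For each $0\le\beta\le\dim_H G_f$ there exists a compact set $K\subset[0,1]$ such that $\dim_H G_f(K)=\beta$. Likewise, for each $0\le\beta\le\dim_P G_f$ there exists a compact set $K\subset[0,1]$ such that $\dim_P G_f(K)=\beta$.
   Context: $G_f=\{(x,f(x)):x\in[0,1]\}\subset\mathbb{R}^2$ is the graph of $f$, and for $K\subset[0,1]$, $G_f(K)=\{(x,f(x)):x\in K\}\subset\mathbb{R}^2$; $\mathbb{R}^2$ has the Euclidean metric. The Hausdorff dimension is $\dim_H F=\inf\{s\ge 0:H^s(F)=0\}$, where $H^s$ is the $s$-dimensional Hausdorff measure. The packing dimension is $\dim_P F=\inf\{s\ge 0:\mathcal{P}^s(F)=0\}$, where $\mathcal{P}^s(F)=\inf\{\sum_{i}\mathcal{P}^s_0(F_i): F\subseteq\bigcup_{i=1}^\infty F_i\}$, $\mathcal{P}^s_0(F)=\lim_{\delta\to0^+}\mathcal{P}^s_\delta(F)$, and $\mathcal{P}^s_\delta(F)$ is the supremum of $\sum_i|B_i|^s$ ($|B_i|$ the diameter of $B_i$) over countable collections $\{B_i\}$ of disjoint balls of radii at most $\delta$ with centres in $F$. *)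

(* Defs.v *)
From HB Require Import structures.
From mathcomp Require Import all_boot all_order all_algebra.
From mathcomp Require Import all_classical all_reals all_analysis.
Set Implicit Arguments.
Unset Strict Implicit.
Unset Printing Implicit Defensive.
Import Order.TTheory GRing.Theory Num.Theory.
Import numFieldNormedType.Exports.
Local Open Scope classical_set_scope.
Local Open Scope ring_scope.

(* The plane is R * R. The library's product metric is the sup metric, hence
   the explicit Euclidean distance. *)
Definition euclid_dist (R : realType) (x y : R * R) : R :=
  Num.sqrt ((x.1 - y.1) ^+ 2 + (x.2 - y.2) ^+ 2).

Definition euclid_ball (R : realType) (c : R * R) (r : R) : set (R * R) :=
  [set y | euclid_dist c y <= r].

(* 0 is added to the set of distances because [ereal_sup set0 = -oo]. *)
Definition diam (R : realType) (A : set (R * R)) : \bar R :=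
  ereal_sup (0%E |` [set (euclid_dist x y)%:E | x in A & y in A]).

(* A countable family is indexed by a set I of naturals. In particular the
   empty family is allowed and an infimum over covers never has to use an empty
   piece, which would count for 1 when s = 0 (and [0 `^ 0 = 1], so H^0 is the
   counting measure). *)
Definition hausdorff_pre (R : realType) (s d : R) (F : set (R * R)) : \bar R :=
  ereal_inf [set z | exists (I : set nat) (U : nat -> set (R * R)),
    [/\ (forall i, I i -> (diam (U i) <= d%:E)%E),
        F `<=` \bigcup_(i in I) U i &
        z = \esum_(i in I) poweR (diam (U i)) s]].

Definition hausdorff_measure (R : realType) (s : R) (F : set (R * R))
    : \bar R :=
  lim (hausdorff_pre s d F @[d --> 0^'+]).

Definition hausdorff_dim (R : realType) (F : set (R * R)) : \bar R :=
  ereal_inf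
    [set s%:E | s in [set s : R | 0 <= s /\ hausdorff_measure s F = 0%E]].

(* Balls are closed, of positive radius; open balls give the same supremum
   (shrink the radii by a factor close to 1). *)
Definition packing_pre (R : realType) (s d : R) (F : set (R * R)) : \bar R :=
  ereal_sup [set z | exists (I : set nat) (c : nat -> R * R) (r : nat -> R),
    [/\ (forall i, I i -> F (c i) /\ 0 < r i <= d),
        trivIset I (fun i => euclid_ball (c i) (r i)) &
        z = \esum_(i in I) poweR (diam (euclid_ball (c i) (r i))) s]].

Definition packing_premeasure (R : realType) (s : R) (F : set (R * R)) : \bar R :=
  lim (packing_pre s d F @[d --> 0^'+]).

Definition packing_measure (R : realType) (s : R) (F : set (R * R)) : \bar R :=
  ereal_inf [set z | exists2 G : nat -> set (R * R),
    F `<=` \bigcup_i G i &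
    z = (\sum_(i <oo) packing_premeasure s (G i))%E].

Definition packing_dim (R : realType) (F : set (R * R)) : \bar R :=
  ereal_inf
    [set s%:E | s in [set s : R | 0 <= s /\ packing_measure s F = 0%E]].

Definition graph_over (R : realType) (f : R -> R) (K : set R) : set (R * R) :=
  [set (x, f x) | x in K].

(* Main.v *)
Require Import Defs.
From HB Require Import structures.
From mathcomp Require Import all_boot all_order all_algebra.
From mathcomp Require Import all_classical all_reals all_analysis.
From mathcomp Require Import ring lra.
Import Order.TTheory GRing.Theory Num.Theory.
Import numFieldNormedType.Exports.
Set Implicit Arguments.
Unset Strict Implicit.
Unset Printing Implicit Defensive.
Local Open Scope classical_set_scope.
Local Open Scope ring_scope.

(** The graph of [f] over [0, 1] is a compact subset of the plane, and any compact
subset of it is the graph over its first projection, which is compact too. So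
the statement is about a compact set [F] of the plane: for each positive [beta]
below its dimension it has a compact subset of dimension [beta]. The two
dimensions need different constructions; in both, the content or the number of
points is brought down to the size belonging to [beta] at all scales at once.

Hausdorff dimension. If [beta] is less than the dimension of [F], the dyadic
squares that meet [F] form a tree of positive net content in dimension [beta]:
the total of side ^ beta over a family of squares that cuts all branches is
bounded below. Subtrees are removed greedily as long as the content of the whole
tree is kept, and the result is a minimal tree ([thinning_min]). Minimality makes
content additive ([minimal_additive]), for if the children of a square had more
content together than the square itself, a tiny subtree could still be removed.
Additivity yields cuts at arbitrarily deep levels with bounded total
([additive_cut]), hence dimension at most [beta]; the positive content bounds all
covers of the limit set from below ([tree_set_content]), hence dimension at least
[beta].

Packing dimension. A set has packing dimension at most [b] exactly when, for each
[t > b], it is a countable union of sets whose 2 ^ - m separated subsets have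
eventually at most 2 ^ (t m) points; such unions are called [sigma_sparse t]
([sigma_sparse_of_packing], [packing_measure_sigma_sparse]). If [beta] is less than
the dimension of [F], then [F] has a nonempty part that is not [sigma_sparse beta]
near any of its points ([rich_kernel]). In it points are chosen in stages: each
stage takes a point chosen before and adds, in a very small ball around it, just
over 2 ^ (beta m) points at mutual distance at least 2 ^ - m, where [m] is the
first scale that admits so many. Each scale sees essentially one stage, so the
closure has at most a constant times 2 ^ (beta k) separated points at scale [k]
([limit_set_count]). Each chosen point is taken infinitely often, and a Baire
category argument then shows that the closure is not [sigma_sparse g] for any
[g < beta] ([limit_set_not_sigma_sparse]). *)

(** * Cuts of a tree and thinning *)

Section Tree.
Context {R : realType} {T : finType} (w : nat -> R) (w_gt0 : forall n, 0 < w n).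
Implicit Types (A B : seq T -> bool) (v u c : seq T) (cs : seq (seq T)).

(** This is the least total weight of a family of words that cuts every branch of
[A] through [v] within [m] levels, computed from the leaves upwards. Its limit
in [m] is the net content of the subtree at [v]: for dyadic squares and the
weight side ^ s it is comparable to the s-dimensional Hausdorff content. *)
Fixpoint cut_at A (m : nat) v : R :=
  if A v then
    if m is m'.+1 then Num.min (w (size v)) (\sum_a cut_at A m' (a :: v))
    else w (size v)
  else 0.

Definition cut_value A v : R := limn (fun m => cut_at A m v).

Lemma cut_at_ge0 A m v : 0 <= cut_at A m v.
Proof.
elim: m v => [|m IH] v /=; case: (A v) => //; first exact: ltW.
by rewrite le_min ltW //= sumr_ge0.
Qed.

Lemma cut_at_le A m v : cut_at A m v <= w (size v).
Proof.
case: m => [|m] /=; case: (A v); rewrite ?ge_min ?lexx ?(ltW (w_gt0 _)) //.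
Qed.

Lemma cut_at_out A m v : ~~ A v -> cut_at A m v = 0.
Proof. by case: m => [|m] /= /negbTE ->. Qed.

Lemma cut_at_nincr A v : nonincreasing_seq (fun m => cut_at A m v).
Proof.
apply/nonincreasing_seqP => n; elim: n v => [|n IH] v.
  by rewrite /=; case: (A v) => //; rewrite ge_min lexx.
rewrite [leRHS]/= [leLHS]/=; case: (A v) => //.
rewrite le_min; apply/andP; split; rewrite ge_min ?lexx //.
by apply/orP; right; apply: ler_sum => a _; exact: IH.
Qed.

Lemma cut_value_cvg A v : cut_at A m v @[m --> \oo] --> cut_value A v.
Proof.
apply: nonincreasing_is_cvgn; first exact: cut_at_nincr.
by exists 0 => _ [m _ <-]; exact: cut_at_ge0.
Qed.

Lemma cut_value_le_at A m v : cut_value A v <= cut_at A m v.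
Proof.
by apply: nonincreasing_cvgn_ge; [exact: cut_at_nincr | exact: cut_value_cvg].
Qed.

Lemma le_cut_value A v x : (forall m, x <= cut_at A m v) -> x <= cut_value A v.
Proof.
move=> xle; apply: limr_ge; first exact: cut_value_cvg.
by apply: nearW => m; exact: xle.
Qed.

Lemma cut_value_ge0 A v : 0 <= cut_value A v.
Proof. by apply: le_cut_value => m; exact: cut_at_ge0. Qed.

Lemma cut_value_le A v : cut_value A v <= w (size v).
Proof. exact: le_trans (cut_value_le_at A 0 v) (cut_at_le _ _ _). Qed.

Lemma cut_value_out A v : ~~ A v -> cut_value A v = 0.
Proof.
move=> Av; apply/eqP; rewrite eq_le cut_value_ge0 andbT.
by rewrite -(cut_at_out 0 Av); exact: cut_value_le_at.
Qed.

Lemma cut_value_approx A v e : 0 < e -> exists m, cut_at A m v < cut_value A v + e.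
Proof.
move=> e0; have /cvgrPdist_lt/(_ _ e0)[N _ /(_ N (leqnn N))] := @cut_value_cvg A v.
rewrite distrC => /(le_lt_trans (ler_norm _)) h; exists N; lra.
Qed.

(** The recursion of [cut_at] survives the limit because [T] is finite: one depth
serves all the children at once. *)
Lemma cut_valueE A v : A v ->
  cut_value A v = Num.min (w (size v)) (\sum_a cut_value A (a :: v)).
Proof.
move=> Av; apply/eqP; rewrite eq_le le_min cut_value_le /=; apply/andP; split.
  apply/ler_addgt0Pr => e e0; pose e' := e / (#|T|.+1)%:R.
  have e'0 : 0 < e' by rewrite divr_gt0.
  have [m_ m_lt] := choice (fun a => cut_value_approx A (a :: v) e'0).
  apply: (le_trans (cut_value_le_at A (\max_a m_ a).+1 v)).
  rewrite /= Av ge_min; apply/orP; right.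
  apply: (@le_trans _ _ (\sum_a (cut_value A (a :: v) + e'))).
    apply: ler_sum => a _; apply: le_trans (ltW (m_lt a)).
    by apply: cut_at_nincr; exact: leq_bigmax.
  rewrite big_split /= lerD2l sumr_const -mulr_natr /e' -mulrA.
  by rewrite ger_pMr // ler_pdivrMl ?ltr0n // mulr1 ler_nat.
apply: le_cut_value => -[|m] /=; rewrite Av; first by rewrite ge_min lexx.
rewrite le_min; apply/andP; split; rewrite ge_min ?lexx //; apply/orP; right.
by apply: ler_sum => a _; exact: cut_value_le_at.
Qed.

Lemma cut_value_mono A B v : (forall u, A u -> B u) ->
  cut_value A v <= cut_value B v.
Proof.
move=> AB; apply: le_cut_value => m; apply: le_trans (cut_value_le_at _ m _) _.
elim: m v => [|m IH] v; rewrite /=; case: ifPn => [/AB -> //|_].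
- by case: ifPn => // _; rewrite ltW.
- rewrite le_min; apply/andP; split; rewrite ge_min ?lexx //.
  by apply/orP; right; apply: ler_sum => a _; exact: IH.
- by case: ifPn => // _; rewrite le_min ltW //= sumr_ge0 // => a _; exact: cut_at_ge0.
Qed.

Lemma eq_cut_value A B v : (forall u, suffix v u -> A u = B u) ->
  cut_value A v = cut_value B v.
Proof.
move=> AB; rewrite /cut_value; congr (limn _); apply/funext => m.
elim: m v AB => [|m IH] v AB /=; rewrite AB ?suffix_refl //.
case: (B v) => //; congr Num.min; apply: eq_bigr => a _; apply: IH => u avu.
by apply: AB; apply: suffix_trans avu; exact: (suffix_suffix [:: a]).
Qed.

Lemma suffix_consr (s t : seq T) x : suffix s (x :: t) = (s == x :: t) || suffix s t.
Proof.
apply/idP/orP => [/suffixP [[|y r] /=]|[/eqP ->|/suffix_trans]].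
- by move=> ->; left.
- by move=> [_ ->]; right; exact: suffix_suffix.
- exact: suffix_refl.
- by apply; exact: suffix_cons.
Qed.

Lemma suffix_child v u : suffix v u -> (size v < size u)%N ->
  exists a, suffix (a :: v) u.
Proof.
move=> /suffixP[r ->]; case/lastP: r => [|r a]; first by rewrite ltnn.
by exists a; rewrite -cats1 -catA; exact: suffix_suffix.
Qed.

Lemma suffix_child_inj a b v u : suffix (a :: v) u -> suffix (b :: v) u -> a = b.
Proof. by rewrite !suffixE /= => /eqP -> /eqP[]. Qed.

(** Changing a tree below [u] only is felt upwards through one child at each level,
and taking the minimum with a fixed weight is 1-Lipschitz. Hence the loss of
content does not grow on the way to the root. *)
Lemma cut_value_path A B u e : (forall y, ~~ suffix u y -> A y = B y) -> 0 <= e ->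
  cut_value A u <= cut_value B u + e ->
  forall v, suffix v u -> cut_value A v <= cut_value B v + e.
Proof.
move=> AB e0; elim: u AB => [|a u IH] AB le v.
  by rewrite suffixs0 => /eqP ->.
rewrite suffix_consr => /orP[/eqP -> //|]; apply: IH => [y uy|].
  by apply: AB; apply: contra uy; apply: suffix_trans; exact: suffix_cons.
have uAB : A u = B u.
  by apply: AB; apply/negP => /size_suffix /=; rewrite ltnn.
have [Bu|Bu] := boolP (B u); last first.
  rewrite (cut_value_out (v := u) (A := A)) ?uAB //.
  by rewrite addr_ge0 // cut_value_ge0.
rewrite !cut_valueE ?uAB //.
have sle : \sum_b cut_value A (b :: u) <= \sum_b cut_value B (b :: u) + e.
  rewrite (bigD1 a) //= [X in _ <= X + _](bigD1 a) //= addrAC lerD //.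
  apply: ler_sum => b ba; rewrite (@eq_cut_value A B) // => y by_.
  apply: AB; apply: contra ba => ay; apply/eqP; exact: suffix_child_inj by_ ay.
have [h|h] := leP (w (size u)) (\sum_b cut_value B (b :: u)).
  by rewrite ge_min lerDl e0.
by rewrite ge_min sle orbT.
Qed.

Definition prune A u : seq T -> bool := fun y => A y && ~~ suffix u y.

(** Step [k] offers the [k]-th word of an enumeration for removal, with its whole
subtree, and removes it unless the root value would fall below [c]. As each
word is offered once and the value is monotone in the tree, the intersection over all steps
is minimal: pruning it at any of its words brings the root value below [c]. *)
Fixpoint greedy A (c : R) (k : nat) : seq T -> bool :=
  if k is k'.+1 then
    let B := greedy A c k' in
    if unpickle k' is Some u then
      if c <= cut_value (prune B u) [::] then prune B u else B
    else B
  else A.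

Definition thinning A (c : R) : seq T -> bool :=
  fun v => `[< forall k, greedy A c k v >].

Lemma greedySE A (c : R) k : greedy A c k.+1 =
  if unpickle k is Some u then
    if c <= cut_value (prune (greedy A c k) u) [::] then prune (greedy A c k) u
    else greedy A c k
  else greedy A c k.
Proof. by []. Qed.

Lemma greedyS A (c : R) k v : greedy A c k.+1 v -> greedy A c k v.
Proof.
by rewrite greedySE; case: unpickle => [u|//]; case: ifP => // _ /andP[].
Qed.

Lemma greedy_le A (c : R) k l v : (k <= l)%N -> greedy A c l v -> greedy A c k v.
Proof.
move=> /subnK <-; elim: (l - k)%N => [//|n IH]; rewrite addSn => /greedyS; exact: IH.
Qed.

Lemma greedy_value A (c : R) k : c <= cut_value A [::] -> c <= cut_value (greedy A c k) [::].
Proof.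
move=> cA; elim: k => [//|k IH]; rewrite greedySE.
by case: unpickle => [u|//]; case: ifP.
Qed.

(** Only finitely many words matter for [cut_at] at a given depth, and each of them
has its final status after finitely many steps. *)
Lemma cut_at_thinning A (c : R) m v :
  exists k, forall l, (k <= l)%N -> cut_at (greedy A c l) m v = cut_at (thinning A c) m v.
Proof.
have self x : exists k, forall l, (k <= l)%N -> greedy A c l x = thinning A c x.
  have [Ax|Ax] := boolP (thinning A c x).
    by exists 0%N => l _; move/asboolP: Ax; apply.
  move/asboolPn: Ax => /existsNP[k /negP nk]; exists k => l kl.
  by apply/negbTE; apply: contra nk; exact: greedy_le.
elim: m v => [|m IH] v.
  by have [k kv] := self v; exists k => l /kv /= ->.
have [k kv] := self v.
have [k_ k_P] := choice (fun a => IH (a :: v)).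
exists (maxn k (\max_a k_ a)) => l; rewrite geq_max => /andP[kl k_l] /=.
rewrite kv //; case: ifP => // _; congr Num.min.
apply: eq_bigr => a _; apply: k_P; apply: leq_trans k_l; exact: leq_bigmax.
Qed.

Lemma thinning_value A (c : R) : c <= cut_value A [::] -> c <= cut_value (thinning A c) [::].
Proof.
move=> cA; apply: le_cut_value => m; have [k /(_ k (leqnn k)) <-] := cut_at_thinning A c m [::].
exact: le_trans (greedy_value k cA) (cut_value_le_at _ _ _).
Qed.

Lemma thinning_min A (c : R) u : thinning A c u ->
  cut_value (prune (thinning A c) u) [::] < c.
Proof.
move=> /asboolP Au; have := Au (pickle u).+1.
move: (pickle u) (pickleK u) => n nK; rewrite greedySE nK.
case: ifPn => [_|]; first by rewrite /prune suffix_refl andbF.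
rewrite -ltNge => + _; apply: le_lt_trans; apply: cut_value_mono => y.
by move=> /andP[/asboolP/(_ n) Ay uy]; rewrite /prune Ay uy.
Qed.

Lemma thinning_sub A (c : R) v : thinning A c v -> A v.
Proof. by move/asboolP/(_ 0%N). Qed.

Definition closed_tree A := forall a v, A (a :: v) -> A v.

Lemma closed_tree_suffix A v u : closed_tree A -> suffix v u -> A u -> A v.
Proof.
by move=> Acl /suffixP[r ->]; elim: r => [//|a r IH] /= /Acl.
Qed.

Lemma thinning_closed A (c : R) : closed_tree A -> closed_tree (thinning A c).
Proof.
move=> Acl a v /asboolP Aav; apply/asboolP => k.
elim: k (Aav k) => [|k IH]; first exact: Acl.
move=> _; move: (Aav k.+1); have := IH (greedyS (Aav k.+1)); rewrite !greedySE; case: unpickle => [u|//].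
case: ifP => // _ Av /andP[_ auv]; rewrite /prune Av /=.
by apply: contra auv => /suffix_trans; apply; exact: suffix_cons.
Qed.

(** Positive content is inherited by some child, hence reaches every depth. *)
Lemma cut_value_gt0_desc A v n : 0 < cut_value A v ->
  exists2 u, suffix v u & size u = (n + size v)%N /\ 0 < cut_value A u.
Proof.
elim: n v => [|n IH] v v0; first by exists v; rewrite ?suffix_refl.
have Av : A v by apply: contraLR v0 => /cut_value_out ->; rewrite ltxx.
move: (v0); rewrite cut_valueE // lt_min => /andP[_].
rewrite lt0r => /andP[/eqP s0 _].
have [[a a0]|no] := pselect (exists a, 0 < cut_value A (a :: v)).
  have [u su [uz u0]] := IH _ a0; exists u; first exact: suffix_trans (suffix_cons _ _) su.
  by rewrite uz /= addnS.
case: s0; apply: big1 => a _; apply/eqP; rewrite eq_le cut_value_ge0 andbT leNgt.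
by apply/negP => a0; apply: no; exists a.
Qed.

(** If the content at [v] were smaller than the sum over its children, it would be
equal to the weight of [v], and there would be a gap to spare. A subtree below
[v] rooted so deep that its weight is less than the gap could then be pruned
without changing the value at [v], hence at the root, against minimality. *)
Lemma minimal_additive A v : (w n @[n --> \oo] --> 0) -> closed_tree A ->
  (forall u, A u -> cut_value (prune A u) [::] < cut_value A [::]) ->
  cut_value A v = \sum_a cut_value A (a :: v).
Proof.
move=> wlim Acl Amin; have [Av|Av] := boolP (A v); last first.
  rewrite cut_value_out // big1 // => a _; rewrite cut_value_out //.
  by apply: contra Av; exact: Acl.
rewrite cut_valueE //.
have [/min_idPr //|wS] := leP (\sum_a cut_value A (a :: v)) (w (size v)); exfalso.
set S := \sum_a _ in wS; pose g := S - w (size v).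
have g0 : 0 < g by rewrite subr_gt0.
have [a0 a00] : exists a, 0 < cut_value A (a :: v).
  apply: contrapT => no; have : S = 0; last by move=> S0; move: (w_gt0 (size v)); lra.
  apply: big1 => a _; apply/eqP; rewrite eq_le cut_value_ge0 andbT leNgt.
  by apply/negP => ap; apply: no; exists a.
have /cvgrPdist_lt/(_ _ g0)[N _ wN] := wlim.
have [u su [uz u0]] := cut_value_gt0_desc N a00.
have wu : w (size u) < g.
  have /wN : (N <= size u)%N by rewrite uz leq_addr.
  by rewrite sub0r normrN gtr0_norm.
have Au : A u by apply: contraLR u0 => /cut_value_out ->; rewrite ltxx.
have suv : suffix v u by exact: suffix_trans (suffix_cons _ _) su.
pose B := prune A u.
have AB y : ~~ suffix u y -> A y = B y by rewrite /B /prune => ->; rewrite andbT.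
have le0 : cut_value A (a0 :: v) <= cut_value B (a0 :: v) + w (size u).
  apply: (cut_value_path AB) su; first exact: ltW.
  by rewrite -[leLHS]add0r lerD ?cut_value_ge0 ?cut_value_le.
have leS : S <= \sum_a cut_value B (a :: v) + w (size u).
  rewrite /S (bigD1 a0) //= [X in _ <= X + _](bigD1 a0) //= addrAC lerD //.
  apply: ler_sum => b ba; rewrite (@eq_cut_value A B) // => y by_.
  apply: AB; apply: contra ba => /(suffix_trans su) ay; apply/eqP.
  exact: suffix_child_inj by_ ay.
have Bv : B v.
  rewrite -AB //; apply/negP => /size_suffix; rewrite uz /= addnS ltnNge.
  by rewrite leq_addl.
have lev : cut_value A v <= cut_value B v + 0.
  rewrite addr0 (cut_valueE Bv) le_min cut_value_le /=.
  apply: le_trans (cut_value_le _ _) _; rewrite /g in wu; lra.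
have ABv y : ~~ suffix v y -> A y = B y.
  by move=> vy; apply: AB; apply: contra vy; exact: suffix_trans.
have := cut_value_path ABv (lexx 0) lev (suffix0s v).
by rewrite addr0 leNgt Amin.
Qed.

(** The depth [M] makes this a condition on finite words; branches need not be
mentioned. *)
Definition is_cut A v cs := exists M, forall u,
  A u -> (M <= size u)%N -> suffix v u -> has (fun c => suffix c u) cs.

Lemma is_cut_node A v (cs : T -> seq (seq T)) :
  (forall a, is_cut A (a :: v) (cs a)) -> is_cut A v (flatten [seq cs a | a <- enum T]).
Proof.
move=> /choice[M_ MP]; exists (maxn (size v).+1 (\max_a M_ a)) => u Au.
rewrite geq_max => /andP[vu Mu] svu; have [a sa] := suffix_child svu vu.
have := MP a u Au (leq_trans (leq_bigmax _) Mu) sa.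
move=> /hasP[c cc cu]; apply/hasP; exists c => //.
by apply/flattenP; exists (cs a) => //; apply: map_f; rewrite mem_enum.
Qed.

Lemma sum_flatten_children (F : seq T -> R) (cs : T -> seq (seq T)) :
  \sum_(c <- flatten [seq cs a | a <- enum T]) F c = \sum_a \sum_(c <- cs a) F c.
Proof. by rewrite big_flatten big_map big_enum. Qed.

Lemma cut_at_cut A m v : closed_tree A -> exists cs, [/\ is_cut A v cs,
  \sum_(c <- cs) w (size c) <= cut_at A m v & all (fun c => size v <= size c)%N cs].
Proof.
move=> Acl; elim: m v => [|m IH] v; rewrite /=; case: ifPn => Av.
- exists [:: v]; split; rewrite ?big_seq1 //= ?leqnn //.
  by exists 0%N => u _ _ svu /=; rewrite svu.
- exists [::]; split; rewrite ?big_nil //; exists 0%N => u Au _ svu.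
  by move: Av; rewrite (closed_tree_suffix Acl svu Au).
- case: leP => _.
    exists [:: v]; split; rewrite ?big_seq1 //= ?leqnn //.
    by exists 0%N => u _ _ svu /=; rewrite svu.
  have [cs csP] := choice (fun a => IH (a :: v)).
  exists (flatten [seq cs a | a <- enum T]); split.
  + by apply: is_cut_node => a; have [] := csP a.
  + by rewrite sum_flatten_children; apply: ler_sum => a _; have [] := csP a.
  + apply/allP => c /flattenP[_ /mapP[a _ ->]]; have [_ _ /allP h] := csP a.
    by move=> /h; exact: ltnW.
- exists [::]; split; rewrite ?big_nil //; exists 0%N => u Au _ svu.
  by move: Av; rewrite (closed_tree_suffix Acl svu Au).
Qed.

(** Additivity moves the content [n] levels down at no cost, so that nearly optimal
cuts can be chosen with all their words at depth at least [n]. *)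
Lemma additive_cut A n v e : closed_tree A -> 0 < e ->
  (forall v, cut_value A v = \sum_a cut_value A (a :: v)) ->
  exists cs, [/\ is_cut A v cs, \sum_(c <- cs) w (size c) <= cut_value A v + e &
    all (fun c => n <= size c)%N cs].
Proof.
move=> Acl + Aadd.
suff: forall e, 0 < e -> exists cs, [/\ is_cut A v cs, \sum_(c <- cs) w (size c) <= cut_value A v + e &
    all (fun c => n + size v <= size c)%N cs].
  move=> h /h[cs [cs1 cs2 cs3]]; exists cs; split => //.
  by apply: sub_all cs3 => c; apply: leq_trans; exact: leq_addr.
move=> {}e; elim: n v e => [|n IH] v e e0.
  have [m /ltW mP] := @cut_value_approx A v _ e0.
  have [cs [cs1 cs2 cs3]] := cut_at_cut m v Acl.
  by exists cs; split => //; exact: le_trans mP.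
pose e' := e / (#|T|.+1)%:R.
have e'0 : 0 < e' by rewrite divr_gt0.
have [cs csP] := choice (fun a => IH (a :: v) e' e'0).
exists (flatten [seq cs a | a <- enum T]); split.
- by apply: is_cut_node => a; have [] := csP a.
- rewrite sum_flatten_children Aadd.
  apply: (@le_trans _ _ (\sum_a (cut_value A (a :: v) + e'))).
    by apply: ler_sum => a _; have [] := csP a.
  rewrite big_split /= lerD2l sumr_const -mulr_natr /e' -mulrA.
  by rewrite ger_pMr // ler_pdivrMl ?ltr0n // mulr1 ler_nat.
- apply/allP => c /flattenP[_ /mapP[a _ ->]]; have [_ _ /allP h] := csP a.
  by move=> /h /=; rewrite addnS.
Qed.

(** In the induction a cut must have no word strictly above the current one: such a
word would cut the subtree without being counted in the sum. *)
Lemma cut_value_le_cut A cs : is_cut A [::] cs ->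
  cut_value A [::] <= \sum_(c <- cs) w (size c).
Proof.
move=> [M MP].
suff: forall m v, (M <= size v + m)%N ->
    (forall c, c \in cs -> suffix c v -> c = v) ->
    cut_at A m v <= \sum_(c <- cs | suffix v c) w (size c).
  move=> /(_ M [::] (leqnn _)) h; apply: le_trans (cut_value_le_at _ M _) _.
  apply: le_trans (h _) _; first by move=> c _; rewrite suffixs0 => /eqP.
  by rewrite (eq_bigl xpredT) // => c; rewrite suffix0s.
(* A word of the cut pays for its own subtree. *)
have self m v : v \in cs -> cut_at A m v <= \sum_(c <- cs | suffix v c) w (size c).
  move=> vcs; apply: le_trans (cut_at_le _ _ _) _.
  rewrite (big_rem v) //= suffix_refl lerDl sumr_ge0 // => c _; exact: ltW.
elim=> [|m IH] v Mv vmin.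
  have [Av|Av] := boolP (A v); last by rewrite cut_at_out ?sumr_ge0 // => *; exact: ltW.
  rewrite addn0 in Mv; have /hasP[c ccs cv] := MP v Av Mv (suffix0s v).
  by apply: self; rewrite -(vmin c).
have [/self //|vcs] := boolP (v \in cs).
rewrite /=; case: ifPn => Av; last by rewrite sumr_ge0 // => *; exact: ltW.
rewrite ge_min; apply/orP; right.
apply: (@le_trans _ _ (\sum_a \sum_(c <- cs | suffix (a :: v) c) w (size c))).
  apply: ler_sum => a _; apply: IH; first by rewrite /= addSnnS.
  move=> c ccs; rewrite suffix_consr => /orP[/eqP //|cv].
  by move: vcs; rewrite -(vmin c) ?ccs.
(* A word strictly below v lies below one child of v only. *)
rewrite (eq_bigr (fun a => \sum_(c <- cs) (if suffix (a :: v) c then w (size c) else 0))).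
  rewrite exchange_big /= [leRHS]big_mkcond /=; apply: ler_sum => c _.
  case: ifPn => vc; last first.
    rewrite big1 // => a _; case: ifP => // avc; move: vc.
    by rewrite (suffix_trans (suffix_cons _ _) avc).
  rewrite -big_mkcond /=.
  have [[a0 a0c]|no] := pselect (exists a, suffix (a :: v) c).
    rewrite (bigD1 a0) //= big1 ?addr0 // => b /andP[bc]; apply: contraNeq => _.
    by apply/eqP; exact: suffix_child_inj bc a0c.
  by rewrite big_pred0 ?ltW // => a; apply/negP => ac; apply: no; exists a.
by move=> a _; rewrite big_mkcond.
Qed.

End Tree.


(** * Dyadic squares *)

Section Plane.
Context {R : realType}.
Implicit Types (x y p q : R * R) (r : R).

Lemma norm_le_euclid x y : `|x - y| <= euclid_dist x y.
Proof.
rewrite prod_normE /= ge_max /euclid_dist -!sqrtr_sqr !ler_wsqrtr //.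
  by rewrite lerDr sqr_ge0.
by rewrite lerDl sqr_ge0.
Qed.

Lemma euclid_le_norm x y : euclid_dist x y <= 2 * `|x - y|.
Proof.
have -> : 2 * `|x - y| = Num.sqrt ((2 * `|x - y|) ^+ 2).
  by rewrite sqrtr_sqr ger0_norm // mulr_ge0.
rewrite /euclid_dist ler_wsqrtr //.
have h1 : (x.1 - y.1) ^+ 2 <= `|x - y| ^+ 2.
  rewrite -[leLHS]real_normK ?num_real // ler_pXn2r ?nnegrE //.
  by rewrite prod_normE le_max lexx.
have h2 : (x.2 - y.2) ^+ 2 <= `|x - y| ^+ 2.
  rewrite -[leLHS]real_normK ?num_real // ler_pXn2r ?nnegrE //.
  by rewrite prod_normE le_max lexx orbT.
have := sqr_ge0 `|x - y|; rewrite exprMn; lra.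
Qed.

End Plane.

Notation word := (seq (bool * bool)).

Section Squares.
Context {R : realType} (M : R) (M_gt0 : 0 < M).
Implicit Types (v u c : word) (p x : R * R).

Definition side (n : nat) : R := 2 * M / 2 ^+ n.

Fixpoint coord (bit : bool * bool -> bool) v : nat :=
  if v is a :: v' then (bit a + (coord bit v').*2)%N else 0%N.

Definition edge bit v : R := - M + side (size v) * (coord bit v)%:R.

Definition interval_of bit v : set R :=
  `[edge bit v, edge bit v + side (size v)].

(** Neighbouring squares share their edges: a point may have several addresses, in
return squares are compact. *)
Definition square v : set (R * R) := interval_of fst v `*` interval_of snd v.

Lemma side_gt0 n : 0 < side n.
Proof. by rewrite divr_gt0 ?exprn_gt0 // mulr_gt0. Qed.

Lemma sideS n : side n = 2 * side n.+1.
Proof. by rewrite /side exprS; field; rewrite expf_neq0. Qed.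

Lemma side_cvg0 : side n @[n --> \oo] --> 0.
Proof.
have h : geometric (2 * M) (2^-1) n @[n --> \oo] --> (0 : R).
  by apply: cvg_geometric; rewrite ger0_norm; lra.
suff -> : side = geometric (2 * M) (2^-1) by [].
by apply/funext => n; rewrite /geometric /= /side exprVn.
Qed.

Lemma side_small e : 0 < e -> exists N, forall n, (N <= n)%N -> side n < e.
Proof.
move=> e0; have /cvgrPdist_lt/(_ _ e0)[N _ NP] := side_cvg0.
by exists N => n /NP; rewrite sub0r normrN gtr0_norm // side_gt0.
Qed.

Lemma interval_child bit a v t : interval_of bit (a :: v) t -> interval_of bit v t.
Proof.
rewrite /interval_of /edge /= !in_itv /= (sideS (size v)) natrD -muln2 natrM.
have := side_gt0 (size v).+1; set s := side _; set c := (coord _ _)%:R.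
by case: (bit a) => /= s0 /andP[h1 h2]; apply/andP; split; lra.
Qed.

Lemma interval_split bit v t : interval_of bit v t ->
  exists b, forall a, bit a = b -> interval_of bit (a :: v) t.
Proof.
rewrite /interval_of /edge /= !in_itv /= (sideS (size v)).
have := side_gt0 (size v).+1; set s := side _; set c := (coord _ _)%:R.
move=> s0 /andP[h1 h2]; have [h|h] := leP t (- M + 2 * s * c + s).
  exists false => a /= ->; rewrite in_itv /= add0n -muln2 natrM -/c.
  by apply/andP; split; lra.
exists true => a /= ->; rewrite in_itv /= natrD -muln2 natrM -/c.
by apply/andP; split; lra.
Qed.

Lemma square_child a v : square (a :: v) `<=` square v.
Proof. by move=> p [/interval_child h1 /interval_child h2]. Qed.

Lemma square_suffix v u : suffix v u -> square u `<=` square v.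
Proof.
move=> /suffixP[s ->]; elim: s => [//|a s IH] p /square_child; exact: IH.
Qed.

Lemma square_split v p : square v p -> exists a, square (a :: v) p.
Proof.
move=> [/interval_split[b1 h1] /interval_split[b2 h2]].
by exists (b1, b2); split; [exact: h1|exact: h2].
Qed.

Lemma square_diam v x y : square v x -> square v y -> `|x - y| <= side (size v).
Proof.
rewrite /square /interval_of /= !in_itv /= => -[/andP[h1 h2] /andP[h3 h4]].
move=> -[/andP[h5 h6] /andP[h7 h8]].
by rewrite prod_normE ge_max /= !ler_norml; apply/andP; split; apply/andP; split; lra.
Qed.

Lemma compact_square v : compact (square v).
Proof. by apply: compact_setX; exact: segment_compact. Qed.

Lemma closed_square v : closed (square v).
Proof. by apply: compact_closed (@compact_square v); exact: norm_hausdorff. Qed.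

Lemma square_neq0 v : square v (edge fst v, edge snd v).
Proof.
rewrite /square /interval_of /= !in_itv /= !lexx /= !lerDl.
by rewrite ltW // side_gt0.
Qed.

Lemma square_root p : `|p| <= M -> square [::] p.
Proof.
rewrite prod_normE ge_max /square /interval_of /edge /= !in_itv /= !ler_norml.
rewrite /side expr0 => /andP[/andP[h1 h2] /andP[h3 h4]].
by split; apply/andP; split; lra.
Qed.

Lemma square_level n p : square [::] p -> exists2 v, size v = n & square v p.
Proof.
move=> p0; elim: n => [|n [v vn /square_split[a vp]]]; first by exists [::].
by exists (a :: v) => //=; rewrite vn.
Qed.

Lemma coord_inj u v : size u = size v -> coord fst u = coord fst v ->
  coord snd u = coord snd v -> u = v.
Proof.
elim: u v => [|[a1 a2] u IH] [|[b1 b2] v] //= [uv].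
have half (b b' : bool) m n : (b + m.*2 = b' + n.*2)%N -> b = b' /\ m = n.
  move=> h; have : odd (b + m.*2) = odd (b' + n.*2) by rewrite h.
  rewrite !oddD !odd_double !addbF !oddb => bb'; split => //.
  by move: h; rewrite bb' => /addnI /double_inj.
by move=> /half[-> h1] /half[-> h2]; rewrite (IH v).
Qed.

(** An interval of length [side k] that comes within [2 * side k] of [t] starts less
than [3 * side k] to the left of [t] and less than [2 * side k] to its right,
so that its index lies among six consecutive integers. *)
Lemma coord_window k (t r : R) : r < 2 * side k ->
  exists m, forall c, size c = k -> forall bit z, interval_of bit c z ->
    `|z - t| < r -> coord bit c \in iota m 6.
Proof.
move=> rs; have s0 := side_gt0 k.
exists (Num.truncn ((t + M) / side k - 3)) => c ck bit z.
rewrite mem_iota /interval_of /edge /= in_itv /= ck => /andP[h1 h2].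
rewrite ltr_norml => /andP[h3 h4].
set T := (t + M) / side k - 3; set X := coord bit c.
have tE : t + M = (T + 3) * side k by rewrite /T; field; rewrite gt_eqF.
have XT : T < X%:R.
  by rewrite -(ltr_pM2r s0) -/X; rewrite -/X in h2; nra.
have TX : X%:R < T + 5.
  by rewrite -(ltr_pM2r s0) -/X; rewrite -/X in h1; nra.
have [T0|T0] := leP 0 T.
  have /andP[t1 t2] := truncn_itv T0.
  apply/andP; split; first by rewrite -(ler_nat R); apply/ltW/(le_lt_trans t1).
  rewrite -(ltr_nat R) natrD; rewrite -addn1 natrD in t2; lra.
have -> : Num.truncn T = 0%N by apply/truncn0Pn; rewrite -ltNge; lra.
by rewrite /= add0n -(ltr_nat R); lra.
Qed.

(** The level is the first one with side at most [r]; then [r < 2 * side] unless it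
is the root level, and [coord_window] leaves 6 * 6 squares. *)
Lemma squares_near_ball x r : 0 < r -> exists cs : seq word,
  [/\ (size cs <= 36)%N, all (fun c => side (size c) <= r) cs &
    exists k, forall u, (k <= size u)%N -> square u `&` [set y | `|y - x| < r] !=set0 ->
      has (fun c => suffix c u) cs].
Proof.
move=> r0; have ex : exists k, side k <= r.
  by have [N /(_ N (leqnn N)) h] := side_small r0; exists N; exact: ltW.
case: (ex_minnP ex) => -[|k] kr kmin.
  exists [:: [::]]; split; rewrite //= ?kr //.
  by exists 0%N => u _ _; rewrite /= suffix0s.
have rs : r < 2 * side k.+1.
  by rewrite -sideS ltNge; apply/negP => /kmin; rewrite ltnn.
have [m1 m1P] := coord_window x.1 rs; have [m2 m2P] := coord_window x.2 rs.
pose meets (t : k.+1.-tuple (bool * bool)) :=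
  `[< square t `&` [set y | `|y - x| < r] !=set0 >].
exists [seq tval t | t <- enum meets]; split.
- pose X c := (coord fst c, coord snd c).
  rewrite -(size_map X) -[36%N]/((size (iota m1 6) * size (iota m2 6))%N).
  rewrite -(size_allpairs pair); apply: uniq_leq_size.
    rewrite -map_comp map_inj_in_uniq ?enum_uniq // => t t' _ _ /= [e1 e2].
    by apply: val_inj; apply: coord_inj; rewrite ?size_tuple.
  move=> _ /mapP[_ /mapP[t +] -> ->]; rewrite mem_enum => /asboolP[y [[y1 y2] yx]].
  have yxr : `|y - x| < r by exact: yx.
  rewrite prod_normE gt_max in yxr; case/andP: yxr => yx1 yx2.
  apply/allpairsP; exists (X t); split => //=.
    by apply: m1P y1 yx1; exact: size_tuple.
  by apply: m2P y2 yx2; exact: size_tuple.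
- by apply/allP => _ /mapP[t _ ->]; rewrite size_tuple.
exists k.+1 => u ku [y [uy yx]].
have sc : size (drop (size u - k.+1) u) == k.+1 by rewrite size_drop subKn.
apply/hasP; exists (drop (size u - k.+1) u); last exact: suffix_drop.
apply/mapP; exists (Tuple sc) => //; rewrite mem_enum; apply/asboolP.
by exists y; split => //; apply: square_suffix uy; exact: suffix_drop.
Qed.

End Squares.


(** * Hausdorff dimension and coverings by squares *)

Section HausdorffDimension.
Context {R : realType}.
Implicit Types (F : set (R * R)) (s d : R).

Lemma diam_ge0 F : (0 <= diam F)%E.
Proof. by apply: ereal_sup_ubound; left. Qed.

Lemma diam_ge F x y : F x -> F y -> ((euclid_dist x y)%:E <= diam F)%E.
Proof.
by move=> Fx Fy; apply: ereal_sup_ubound; right; exists x => //; exists y.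
Qed.

Lemma diam_le F d : 0 <= d -> (forall x y, F x -> F y -> euclid_dist x y <= d) ->
  (diam F <= d%:E)%E.
Proof.
move=> d0 Fd; apply: ge_ereal_sup => _ [->|[x Fx [y Fy <-]]]; rewrite lee_fin //.
exact: Fd.
Qed.

Lemma poweR_le (a b : \bar R) s : 0 <= s -> (0 <= a)%E -> (a <= b)%E ->
  (a `^ s <= b `^ s)%E.
Proof.
move=> s0 a0 ab; apply: gt0_ler_poweR => //; rewrite in_itv /= leey andbT //.
exact: le_trans ab.
Qed.

(** The case [a = 0] is included: it is what allows pieces of diameter 0. *)
Lemma powR_exp_le (a s t : R) : 0 <= a -> a <= 1 -> s <= t -> 0 < t ->
  a `^ t <= a `^ s.
Proof.
rewrite le_eqVlt => /orP[/eqP <-|a0] a1 st t0.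
  by rewrite powR0 ?gt_eqF // powR_ge0.
rewrite /powR gt_eqF // ler_expR ler_wnM2r //; exact: ln_le0.
Qed.

Lemma hausdorff_pre_ge0 s d F : (0 <= hausdorff_pre s d F)%E.
Proof.
apply: le_ereal_inf_tmp => _ [I [U [_ _ ->]]]; apply: esum_ge0 => i _.
exact: poweR_ge0.
Qed.

Lemma hausdorff_pre_cvg s F : hausdorff_pre s d F @[d --> 0^'+] -->
  ereal_sup [set hausdorff_pre s d F | d in [set d | 0 < d]].
Proof.
have -> : [set hausdorff_pre s d F | d in [set d : R | 0 < d]] =
    [set hausdorff_pre s d F | d in [set` Interval (BRight 0) (BInfty R false)]].
  congr (image _ _); apply/seteqP; split => x /=; rewrite in_itv /= andbT //.
apply: nonincreasing_at_right_cvge => // x y _ _ xy.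
apply: ereal_inf_le_tmp => _ [I [U [Ux FU ->]]]; exists I, U; split => // i Ii.
by apply: le_trans (Ux i Ii) _; rewrite lee_fin.
Qed.

Lemma hausdorff_measureE s F : hausdorff_measure s F =
  ereal_sup [set hausdorff_pre s d F | d in [set d | 0 < d]].
Proof. apply/cvg_lim; [exact: ereal_hausdorff|exact: hausdorff_pre_cvg]. Qed.

Lemma hausdorff_dim_ge s F : 
  (forall t, 0 <= t -> t < s -> hausdorff_measure t F != 0%E) ->
  (s%:E <= hausdorff_dim F)%E.
Proof.
move=> h; apply: le_ereal_inf_tmp => _ [t [t0 Ht] <-]; rewrite lee_fin leNgt.
by apply/negP => /(h t t0); rewrite Ht eqxx.
Qed.

Lemma hausdorff_dim_le s F : 0 <= s -> hausdorff_measure s F = 0%E ->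
  (hausdorff_dim F <= s%:E)%E.
Proof. by move=> s0 Hs; apply: ereal_inf_lbound; exists s. Qed.

(** For covers by sets of diameter at most 1, lowering the exponent below [beta]
only increases the sums. *)
Lemma hausdorff_dim_lower (beta c : R) F : 0 < c -> 
  (forall (I : set nat) U, (forall i, I i -> (diam (U i) <= 1)%E) ->
    F `<=` \bigcup_(i in I) U i ->
    (c%:E <= \esum_(i in I) poweR (diam (U i)) beta)%E) ->
  (beta%:E <= hausdorff_dim F)%E.
Proof.
move=> c0 cov; apply: hausdorff_dim_ge => t t0 tb; apply/eqP => Ht.
have : (c%:E <= hausdorff_measure t F)%E; last by rewrite Ht lee_fin leNgt c0.
rewrite hausdorff_measureE; apply: (@le_trans _ _ (hausdorff_pre t 1 F)); last first.
  by apply: ereal_sup_ubound; exists 1 => //=.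
apply: le_ereal_inf_tmp => _ [I [U [U1 FU ->]]].
apply: le_trans (cov I U U1 FU) _; apply: le_esum => i /U1.
have := diam_ge0 (U i); case: (diam (U i)) => [r| |] //.
rewrite !lee_fin => r0 r1.
by apply: powR_exp_le => //; [exact: ltW|exact: le_lt_trans tb].
Qed.

Context (M : R) (M_gt0 : 0 < M).
Notation sq := (square M).
Notation side := (side M).

Definition square_cover F (cs : seq word) :=
  forall p, F p -> exists2 c, c \in cs & sq c p.

Lemma diam_square c : (diam (sq c) <= (2 * side (size c))%:E)%E.
Proof.
apply: diam_le => [|x y cx cy]; first by rewrite mulr_ge0 // ltW // side_gt0.
by apply: le_trans (euclid_le_norm _ _) _; rewrite ler_pM2l // square_diam.
Qed.

Lemma hausdorff_pre_squares s d F cs : 0 <= s -> square_cover F cs ->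
  (forall c, c \in cs -> 2 * side (size c) <= d) ->
  (hausdorff_pre s d F <= (\sum_(c <- cs) (2 * side (size c)) `^ s)%:E)%E.
Proof.
move=> s0 Fcs csd; pose U i := sq (nth [::] cs i).
apply: (@le_trans _ _ (\esum_(i in `I_(size cs)) poweR (diam (U i)) s)).
  apply: ereal_inf_lbound; exists `I_(size cs), U; split => //.
    move=> i ilt; apply: le_trans (diam_square _) _; rewrite lee_fin csd //.
    exact: mem_nth.
  move=> p /Fcs[c ccs cp]; exists (index c cs); first by rewrite /= index_mem.
  by rewrite /U nth_index.
rewrite esum_fset; [|exact: finite_II|by move=> *; exact: poweR_ge0].
rewrite -fsbig_ord /= (big_nth [::]) big_mkord -sumEFin; apply: lee_sum => i _.
rewrite -poweR_EFin; apply: poweR_le => //; [exact: diam_ge0|exact: diam_square].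
Qed.

Lemma side_powR_small (e t : R) : 0 < e -> 0 < t ->
  exists N, forall n, (N <= n)%N -> side n `^ t < e.
Proof.
move=> e0 t0; have [N NP] := side_small M_gt0 (powR_gt0 t^-1 e0).
exists N => n /NP /(gt0_ltr_powR t0); rewrite -powRrM mulVf ?gt_eqF // powRr1 ?ltW //.
by apply; rewrite nnegrE ?powR_ge0 // ltW // side_gt0.
Qed.

(** A small total weight forces every single square of the cover to be small, so
the mesh condition of the measure comes for free. *)
Lemma hausdorff_measure_eq0 s F : 0 < s ->
  (forall e, 0 < e -> exists2 cs, square_cover F cs &
    \sum_(c <- cs) side (size c) `^ s < e) ->
  hausdorff_measure s F = 0%E.
Proof.
move=> s0 small; apply/eqP; rewrite eq_le; apply/andP; split; last first.
  rewrite hausdorff_measureE; apply: (@le_trans _ _ (hausdorff_pre s 1 F)).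
    exact: hausdorff_pre_ge0.
  by apply: ereal_sup_ubound; exists 1 => //=.
rewrite hausdorff_measureE; apply: ge_ereal_sup => _ [d /= d0 <-].
apply/lee_addgt0Pr => e e0; rewrite add0e.
have t0 : 0 < (2 : R) `^ s by exact: powR_gt0.
have [cs Fcs cse] : exists2 cs, square_cover F cs &
    \sum_(c <- cs) side (size c) `^ s < Num.min ((d / 2) `^ s) (e / 2 `^ s).
  by apply: small; rewrite lt_min powR_gt0 ?divr_gt0.
move: cse; rewrite lt_min => /andP[csd cse].
apply: le_trans (hausdorff_pre_squares (ltW s0) Fcs (d := d) _) _.
  move=> c ccs; have : side (size c) `^ s < (d / 2) `^ s.
    apply: le_lt_trans csd; rewrite (big_rem c) //= lerDl sumr_ge0 // => *.
    exact: powR_ge0.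
  move=> h; rewrite leNgt; apply/negP => sided.
  have dle : d / 2 <= side (size c) by lra.
  have := ge0_ler_powR (ltW s0) _ _ dle; rewrite leNgt h !nnegrE.
  by rewrite divr_ge0 ?(ltW d0) // ltW ?side_gt0 // => /(_ isT isT).
rewrite lee_fin (eq_bigr (fun c => 2 `^ s * side (size c) `^ s)); last first.
  by move=> c _; rewrite powRM // ltW // side_gt0.
by rewrite -mulr_sumr -ler_pdivlMl // mulrC ltW.
Qed.

(** For an exponent [beta + t], covers of level at least [n] gain the factor
[side n `^ t], which tends to 0. *)
Lemma hausdorff_dim_upper (beta C : R) F : 0 <= beta ->
  (forall n, exists cs, [/\ square_cover F cs, all (fun c => n <= size c)%N cs &
    \sum_(c <- cs) side (size c) `^ beta <= C]) ->
  (hausdorff_dim F <= beta%:E)%E.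
Proof.
move=> b0 cov; apply/lee_addgt0Pr => t t0; rewrite -EFinD.
apply: hausdorff_dim_le; first by rewrite addr_ge0 // ltW.
apply: hausdorff_measure_eq0; first by rewrite ltr_wpDl.
have C0 : 0 <= C.
  have [cs [_ _]] := cov 0%N; apply: le_trans; apply: sumr_ge0 => *; exact: powR_ge0.
move=> e e0; have e'0 : 0 < e / (C + 1) by rewrite divr_gt0 // ltr_wpDl.
have [n nP] := side_powR_small e'0 t0.
have [cs [Fcs csn csC]] := cov n; exists cs => //.
apply: (@le_lt_trans _ _ (e / (C + 1) * C)); last first.
  by rewrite -mulrA gtr_pMr // mulrC ltr_pdivrMr ?mul1r; lra.
apply: (@le_trans _ _ (\sum_(c <- cs) e / (C + 1) * side (size c) `^ beta)).
  rewrite big_seq [leRHS]big_seq; apply: ler_sum => c ccs.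
  rewrite powRD; last by rewrite (gt_eqF (side_gt0 M_gt0 _)) implybT.
  by rewrite mulrC ler_wpM2r ?powR_ge0 // ltW // nP // (allP csn).
by rewrite -mulr_sumr ler_wpM2l // ltW.
Qed.

End HausdorffDimension.


(** * Compact sets carried by trees of squares *)

Section PlaneTopology.
Context {R : realType}.
Implicit Types (F : set (R * R)) (p q : R * R).

Lemma nbhs_plane p (B : set (R * R)) :
  nbhs p B <-> exists2 e, 0 < e & forall q, `|q - p| < e -> B q.
Proof.
split=> [/nbhs_ballP[e e0 eB]|[e e0 eB]].
  exists e => // q qp; apply: eB; rewrite prod_norm_ball /ball_ /=.
  by rewrite distrC.
apply/nbhs_ballP; exists e => //= q; rewrite prod_norm_ball /ball_ /= distrC.
exact: eB.
Qed.

Lemma closed_plane F p : closed F ->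
  (forall e, 0 < e -> exists2 q, F q & `|q - p| < e) -> F p.
Proof.
move=> Fcl h; apply: Fcl => B /nbhs_plane[e e0 eB].
by have [q Fq qp] := h e e0; exists q; split => //; exact: eB.
Qed.

Lemma compact_plane_bound F : compact F ->
  exists2 M : R, 0 < M & forall p, F p -> `|p| <= M.
Proof.
move=> /compact_bounded/(@ex_strict_bound_gt0 _ _ _ _ _ _)[M M0 FM].
by exists M => // p Fp; apply/ltW; exact: FM.
Qed.

Lemma compact_cluster F (p : nat -> R * R) : compact F -> (forall n, F (p n)) ->
  exists2 q, F q & forall e N, 0 < e -> exists2 n, (N <= n)%N & `|p n - q| < e.
Proof.
move=> Fc Fp; have [q [Fq qc]] : F `&` cluster (p n @[n --> \oo]) !=set0.
  by apply: Fc; exists 0%N => //= n _; exact: Fp.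
exists q => // e N e0.
have [] := qc [set p n | n in [set n | (N <= n)%N]] [set x | `|x - q| < e].
- by exists N => // n Nn; exists n.
- by apply/nbhs_plane; exists e.
by move=> _ [[n Nn <-] nq]; exists n.
Qed.

End PlaneTopology.

Section SquareTree.
Context {R : realType} (M : R) (M_gt0 : 0 < M).
Notation sq := (square M).
Notation side := (side M).

(** The words chosen at different levels need not lie on one branch: as an
intersection over the levels the set is plainly closed, and the cuts of [A]
still cover it. *)
Definition tree_set (A : word -> bool) : set (R * R) :=
  [set p | forall n, exists v, [/\ A v, size v = n & sq v p]].

Lemma closed_tree_set A : closed (tree_set A).
Proof.
have -> : tree_set A = \bigcap_n \bigcup_(t in [set t : n.-tuple _ | A t]) sq t.
  apply/seteqP; split => p h n.
    by move=> _; have [v [Av /eqP vn vp]] := h n; exists (Tuple vn).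
  by have [t At tp] := h n I; exists t; rewrite size_tuple.
apply: closed_bigI => n _; apply: closed_bigcup; first exact: finite_finset.
by move=> t _; exact: closed_square.
Qed.

Lemma compact_tree_set A : compact (tree_set A).
Proof.
apply: subclosed_compact (@closed_tree_set A) (@compact_square _ M [::]) _.
by move=> p /(_ 0%N)[v [_ /size0nil -> ]].
Qed.

Lemma tree_set_cover A cs : is_cut A [::] cs -> square_cover M (tree_set A) cs.
Proof.
move=> [N cut] p /(_ N)[v [Av vN vp]].
have /hasP[c ccs cv] : has (fun c => suffix c v) cs.
  by apply: cut; rewrite ?vN ?suffix0s.
by exists c => //; exact: square_suffix cv _ vp.
Qed.

(** Otherwise squares of the tree at deeper and deeper levels would miss more and
more of the sets [O i]; their corners would accumulate at a point of [tree_set A]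
that lies in none of them. All levels beyond [n] are needed because a large
square may meet [O i] when its small subsquares do not. *)
Lemma tree_set_compactness A (O : nat -> set (R * R)) : closed_tree A ->
  (forall i p, O i p -> exists2 e, 0 < e & forall q, `|q - p| < e -> O i q) ->
  tree_set A `<=` \bigcup_i O i ->
  exists n, forall u, A u -> (n <= size u)%N ->
    exists2 i, (i <= n)%N & sq u `&` O i !=set0.
Proof.
move=> Acl Oop cov; apply: contrapT => no.
have bad n : exists u, [/\ A u, (n <= size u)%N &
    forall i, (i <= n)%N -> ~ (sq u `&` O i !=set0)].
  apply: contrapT => nn; apply: no; exists n => u Au nu.
  apply: contrapT => nex; apply: nn; exists u; split => // i ilen iu.
  by apply: nex; exists i.
have [u uP] := choice bad; pose p n := (edge M fst (u n), edge M snd (u n)).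
have pu n : sq (u n) (p n) by exact: square_neq0.
have p0 n : sq [::] (p n) by apply: square_suffix (pu n) => //; exact: suffix0s.
have [q q0 qc] := compact_cluster (@compact_square _ M [::]) p0.
have Eq : tree_set A q.
  move=> k.
  pose C := \bigcup_(t in [set t : k.-tuple (bool * bool) | A t]) sq t.
  have [t At tq] : C q; last by exists t; rewrite size_tuple.
  apply: closed_plane => [|e e0].
    by apply: closed_bigcup => [|t _]; [exact: finite_finset|exact: closed_square].
  have [n kn nq] := qc e k e0; exists (p n) => //.
  have [Au nu _] := uP n; have ku := leq_trans kn nu.
  have st : size (drop (size (u n) - k) (u n)) == k by rewrite size_drop subKn.
  exists (Tuple st) => /=.
    by apply: closed_tree_suffix Acl _ Au; exact: suffix_drop.
  by apply: square_suffix (pu n) => //; exact: suffix_drop.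
have [i _ /Oop[e e0 eO]] := cov q Eq.
have [n ni nq] := qc e i e0; have [_ _ /(_ i ni)] := uP n; apply.
by exists (p n); split => //; exact: eO.
Qed.

End SquareTree.

Section EnclosingBall.
Context {R : realType}.

(** The error [eta] serves the sets of diameter 0, which still need a ball of
positive radius. *)
Lemma enclosing_ball (U : set (R * R)) (beta eta : R) : 0 < beta -> 0 < eta ->
  (diam U <= 1)%E -> exists x r, [/\ 0 < r, U `<=` [set y | `|y - x| < r] &
    ((r `^ beta)%:E <= (2 `^ beta)%:E * poweR (diam U) beta + eta%:E)%E].
Proof.
move=> b0 eta0; have := diam_ge0 U; case dU : (diam U) => [d| |] //.
rewrite !lee_fin => d0 d1; have [x Ux] : exists x, U !=set0 -> U x.
  by have [[x Ux]|no] := pselect (U !=set0); [exists x|exists 0].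
have Ud y : U y -> `|y - x| <= d.
  move=> Uy; apply: le_trans (norm_le_euclid _ _) _.
  by rewrite -lee_fin -dU; apply: diam_ge => //; apply: Ux; exists y.
rewrite poweR_EFin -EFinM -EFinD.
move: d0; rewrite le_eqVlt => /orP[/eqP d0|d0].
  exists x, (eta `^ beta^-1); split; first exact: powR_gt0.
    by move=> y /Ud /= h; apply: le_lt_trans h _; rewrite -d0 powR_gt0.
  rewrite lee_fin -powRrM mulVf ?gt_eqF // powRr1 ?(ltW eta0) //.
  by rewrite lerDr mulr_ge0 // powR_ge0.
exists x, (2 * d); split; first by rewrite mulr_gt0.
  by move=> y /Ud /= h; apply: le_lt_trans h _; lra.
by rewrite lee_fin powRM ?lerDl // ltW.
Qed.

Lemma esum_ge_seq (I : set nat) (a : nat -> \bar R) (J : seq nat) : uniq J ->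
  (forall i, i \in J -> I i) -> (\sum_(i <- J) a i <= \esum_(i in I) a i)%E.
Proof.
move=> Ju JI; apply: esum_ge; exists [set` J]; last by rewrite fsbig_seq.
by split; [exact: finite_seq|move=> i /=; exact: JI].
Qed.

End EnclosingBall.


(** * Compact subsets of prescribed Hausdorff dimension *)

Section HausdorffSubset.
Context {R : realType} (M : R) (M_gt0 : 0 < M) (beta : R) (beta_gt0 : 0 < beta).
Notation sq := (square M).
Notation side := (side M).

Definition weight (n : nat) : R := side n `^ beta.

Lemma weight_gt0 n : 0 < weight n.
Proof. by apply: powR_gt0; exact: side_gt0. Qed.

Lemma weight_cvg0 : weight n @[n --> \oo] --> 0.
Proof.
apply/cvgrPdist_lt => e e0; have [N NP] := side_powR_small M_gt0 e0 beta_gt0.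
by exists N => // n /NP; rewrite sub0r normrN gtr0_norm // weight_gt0.
Qed.

Definition squares_meeting (F : set (R * R)) : word -> bool :=
  fun v => `[< sq v `&` F !=set0 >].

Lemma squares_meeting_closed F : closed_tree (squares_meeting F).
Proof.
move=> a v /asboolP[p [vp Fp]]; apply/asboolP; exists p; split => //.
exact: square_child vp.
Qed.

Lemma tree_set_squares_meeting F (A : word -> bool) : closed F -> (forall v, A v -> squares_meeting F v) ->
  tree_set M A `<=` F.
Proof.
move=> Fcl AF p Ap; apply: (closed_plane Fcl) => e e0.
have [n nP] := side_small M_gt0 e0; have [v [/AF /asboolP[q [vq Fq]] vn vp]] := Ap n.
exists q => //; apply: le_lt_trans (square_diam vq vp) _.
by apply: nP; rewrite vn.
Qed.

(** A root value 0 would give cuts of arbitrarily small total weight, that is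
covers of [F] by squares showing that its measure vanishes. *)
Lemma cut_value_squares_meeting F : (forall p, F p -> `|p| <= M) ->
  hausdorff_measure beta F != 0%E -> 0 < cut_value weight (squares_meeting F) [::].
Proof.
move=> FM; apply: contraR; rewrite -leNgt => c0; apply/eqP.
apply: (hausdorff_measure_eq0 M_gt0) => // e e0.
have [m mP] := @cut_value_approx _ _ _ weight_gt0 (squares_meeting F) [::] _ e0.
have [cs [[N cut] csm _]] := cut_at_cut weight m [::] (@squares_meeting_closed F).
exists cs; last by apply: le_lt_trans csm _; lra.
move=> p Fp; have [v vN vp] := square_level M_gt0 N (square_root (FM p Fp)).
have /hasP[c ccs cv] : has (fun c => suffix c v) cs.
  by apply: cut; rewrite ?vN ?suffix0s //; apply/asboolP; exists p.
by exists c => //; exact: square_suffix cv _ vp.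
Qed.

(** Every set of a cover is replaced by a slightly larger ball, and every ball by at
most 36 squares no larger than itself. By compactness finitely many of
these squares cut the tree, so their total weight is at least its root value. *)
Lemma tree_set_content (A : word -> bool) (U : nat -> set (R * R)) (I : set nat) : closed_tree A ->
  (forall i, I i -> (diam (U i) <= 1)%E) ->
  tree_set M A `<=` \bigcup_(i in I) U i ->
  ((cut_value weight A [::])%:E <=
    (72 * 2 `^ beta)%:E * \esum_(i in I) poweR (diam (U i)) beta)%E.
Proof.
move=> Acl U1 cov; set c := cut_value _ _ _.
have c0 : 0 <= c by exact: cut_value_ge0 weight_gt0 _ _.
move: c0; rewrite le_eqVlt => /orP[/eqP <-|c0].
  rewrite mule_ge0 ?lee_fin ?mulr_ge0 ?powR_ge0 //.
  by apply: esum_ge0 => *; exact: poweR_ge0.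
(* The errors eta i sum to c / 72; multiplied by 36 they use half of c. *)
pose eta i : R := c / 72 / 2 ^+ i.+1.
have eta0 i : 0 < eta i by rewrite !divr_gt0 ?exprn_gt0.
have ballP i : exists xr : (R * R) * R, I i -> [/\ 0 < xr.2,
    U i `<=` [set y | `|y - xr.1| < xr.2] &
    ((xr.2 `^ beta)%:E <= (2 `^ beta)%:E * poweR (diam (U i)) beta + (eta i)%:E)%E].
  have [Ii|nI] := pselect (I i); last by exists (0, 0).
  by have [x [r xr]] := enclosing_ball beta_gt0 (eta0 i) (U1 i Ii); exists (x, r).
have {ballP} [xr xrP] := choice ballP.
pose O i := [set y | I i /\ `|y - (xr i).1| < (xr i).2].
have [||n nP] := @tree_set_compactness _ _ M_gt0 A O Acl.
- move=> i p [Ii ip]; exists ((xr i).2 - `|p - (xr i).1|); first by rewrite subr_gt0.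
  move=> q qp; split => //; rewrite -(subrK p q) -addrA.
  by apply: le_lt_trans (ler_normD _ _) _; lra.
- by move=> p /cov[i Ii Uip]; exists i => //; split=> //; have [_ /(_ _ Uip)] := xrP i Ii.
have wordsP i : exists cs : seq word, I i -> [/\ (size cs <= 36)%N,
    all (fun c => side (size c) <= (xr i).2) cs &
    exists k, forall u, (k <= size u)%N -> sq u `&` O i !=set0 ->
      has (fun c => suffix c u) cs].
  have [Ii|nI] := pselect (I i); last by exists [::].
  have [r0 _ _] := xrP i Ii.
  have [cs [cs1 cs2 [k kP]]] := squares_near_ball M_gt0 (xr i).1 r0.
  exists cs => _; split => //; exists k => u ku [y [uy [_ iy]]].
  by apply: kP => //; exists y.
have {wordsP} [cs csP] := choice wordsP.
have kP i : exists k, I i -> forall u, (k <= size u)%N -> sq u `&` O i !=set0 ->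
      has (fun c => suffix c u) (cs i).
  have [Ii|nI] := pselect (I i); last by exists 0%N.
  by have [_ _ [k kP]] := csP i Ii; exists k.
have {kP} [k kP] := choice kP.
pose J := [seq i <- iota 0 n.+1 | `[< I i >]].
have JI i : i \in J -> I i by rewrite mem_filter => /andP[/asboolP].
have cut : is_cut A [::] (flatten [seq cs i | i <- J]).
  exists (maxn n (\max_(i < n.+1) k i)) => u Au; rewrite geq_max => /andP[nu ku] _.
  have [i ilen [y [uy Oy]]] := nP u Au nu; have Ii : I i by case: Oy.
  have iJ : i \in J.
    by rewrite mem_filter mem_iota /= add0n ltnS ilen andbT; apply/asboolP.
  have /hasP[d dcs du] : has (fun d => suffix d u) (cs i).
    apply: kP Ii _ _ _; last by exists y.
    apply: leq_trans ku; rewrite -ltnS in ilen.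
    exact: (@leq_bigmax _ (fun j : 'I_n.+1 => k j) (Ordinal ilen)).
  by apply/hasP; exists d => //; apply/flattenP; exists (cs i) => //; exact: map_f.
have := cut_value_le_cut weight_gt0 cut; rewrite -/c big_flatten big_map => cle.
have le1 : c <= \sum_(i <- J) 36 * (xr i).2 `^ beta.
  apply: le_trans cle _; rewrite big_seq [leRHS]big_seq; apply: ler_sum => i /JI Ii.
  have [cs36 /allP csr _] := csP i Ii.
  apply: (@le_trans _ _ (\sum_(d <- cs i) (xr i).2 `^ beta)).
    rewrite big_seq [leRHS]big_seq; apply: ler_sum => d /csr dr.
    apply: ge0_ler_powR dr; rewrite ?nnegrE ?(ltW beta_gt0) //.
      by rewrite ltW // side_gt0.
    by have [/ltW] := xrP i Ii.
  rewrite big_const_seq count_predT iter_addr addr0 -[leLHS]mulr_natl.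
  by rewrite ler_wpM2r ?powR_ge0 // ler_nat.
have Ju : uniq J by rewrite filter_uniq // iota_uniq.
set S := esum _ _.
have le2 : (c%:E <= 36%:E * ((2 `^ beta)%:E * S + (c / 72)%:E))%E.
  apply: (@le_trans _ _ (\sum_(i <- J) 36%:E *
      ((2 `^ beta)%:E * poweR (diam (U i)) beta + (eta i)%:E))%E).
    apply: (@le_trans _ _ (\sum_(i <- J) 36 * (xr i).2 `^ beta)%:E); first by rewrite lee_fin.
    rewrite -sumEFin big_seq [leRHS]big_seq; apply: lee_sum => i /JI /xrP[_ _ h].
    by rewrite EFinM; apply: lee_wpmul2l.
  rewrite -ge0_sume_distrr; last first.
    move=> i _; rewrite adde_ge0 ?lee_fin ?(ltW (eta0 _)) //.
    by rewrite mule_ge0 ?poweR_ge0 // lee_fin powR_ge0.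
  apply: lee_wpmul2l => //; rewrite big_split /=; apply: leeD.
    rewrite -ge0_sume_distrr; last by move=> *; exact: poweR_ge0.
    apply: lee_wpmul2l; first by rewrite lee_fin powR_ge0.
    exact: esum_ge_seq.
  rewrite sumEFin lee_fin.
  apply: (@le_trans _ _ (\sum_(i <- iota 0 n.+1) eta i)).
    by rewrite big_filter big_mkcond; apply: ler_sum => i _; case: ifP => // _; exact: ltW.
  have -> : iota 0 n.+1 = index_iota 0 n.+1 by [].
  suff: forall m, \sum_(0 <= i < m) eta i = c / 72 * (1 - (2 ^+ m)^-1).
    move=> ->; by rewrite ger_pMr ?divr_gt0 // gerBl invr_ge0 exprn_ge0.
  elim=> [|m IHm]; first by rewrite big_geq // expr0 invr1 subrr mulr0.
  by rewrite big_nat_recr //= IHm /eta exprS; field; rewrite expf_neq0.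
move: le2; case: S => [s| |].
- rewrite !lee_fin; lra.
- by move=> _; rewrite gt0_muley ?leey // lte_fin mulr_gt0 // powR_gt0.
- by rewrite gt0_muleNy ?lte_fin ?powR_gt0 // addNye gt0_muleNy ?lte_fin.
Qed.

End HausdorffSubset.

(** The tree of the squares meeting [F] is thinned down to a minimal tree of the same
root value, whose limit set has both dimension bounds: additivity gives covers
of bounded weight by arbitrarily small squares, and the root value bounds all
covers from below. *)
Lemma compact_subset_hausdorff {R : realType} (F : set (R * R)) (beta : R) :
  compact F -> 0 < beta -> hausdorff_measure beta F != 0%E ->
  exists E, [/\ compact E, E `<=` F & hausdorff_dim E = beta%:E].
Proof.
move=> Fc b0 HF; have [M M0 FM] := compact_plane_bound Fc.
have w0 := @weight_gt0 _ M M0 beta.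
pose T := squares_meeting M F; pose c := cut_value (weight M beta) T [::].
have c0 : 0 < c by exact: cut_value_squares_meeting.
pose A := thinning (weight M beta) T c.
have Acl : closed_tree A by apply: thinning_closed; exact: squares_meeting_closed.
have cA : c <= cut_value (weight M beta) A [::] by exact: thinning_value.
have Aadd v : cut_value (weight M beta) A v =
    \sum_a cut_value (weight M beta) A (a :: v).
  apply: minimal_additive => //; first exact: weight_cvg0.
  by move=> u Au; apply: lt_le_trans cA; exact: thinning_min.
exists (tree_set M A); split; first exact: compact_tree_set.
- apply: tree_set_squares_meeting => //.
    by apply: compact_closed Fc; exact: norm_hausdorff.
  by move=> v; exact: thinning_sub.
apply/eqP; rewrite eq_le; apply/andP; split.
  apply: (hausdorff_dim_upper M0 (C := cut_value (weight M beta) A [::] + 1)).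
    exact: ltW.
  move=> n; have [cs [cs1 cs2 cs3]] := additive_cut w0 n [::] Acl ltr01 Aadd.
  by exists cs; split => //; exact: tree_set_cover.
pose K := 72 * (2 : R) `^ beta; have K0 : 0 < K by rewrite mulr_gt0 // powR_gt0.
apply: (@hausdorff_dim_lower _ _ (c / K)); first by rewrite divr_gt0.
move=> I U U1 cov; have := tree_set_content M0 b0 Acl U1 cov; rewrite -/K.
case: esum => [s| |]; last 2 first.
- by rewrite leey.
- by rewrite gt0_muleNy ?lte_fin // leeNy_eq.
by rewrite -EFinM !lee_fin ler_pdivrMr // mulrC; exact: le_trans.
Qed.


(** * Packing dimension and separated sets *)

Section PackingDimension.
Context {R : realType}.
Implicit Types (S F G : set (R * R)) (s t d g b : R) (m k : nat) (l : seq (R * R)).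

Definition mesh m : R := (2 ^+ m)^-1.

Lemma mesh_gt0 m : 0 < mesh m.
Proof. by rewrite invr_gt0 exprn_gt0. Qed.

Lemma meshS m : mesh m = 2 * mesh m.+1.
Proof. by rewrite /mesh exprS; field; rewrite expf_neq0. Qed.

Lemma mesh_nincr m k : (m <= k)%N -> mesh k <= mesh m.
Proof.
move=> mk; rewrite /mesh lef_pV2 ?posrE ?exprn_gt0 //.
by rewrite ler_weXn2l // ler1n.
Qed.

Lemma mesh_small e : 0 < e -> exists N, forall n, (N <= n)%N -> mesh n < e.
Proof.
move=> e0; have [N NP] := @side_small R 1 ltr01 (2 * e) (mulr_gt0 (ltr0n _ 2) e0).
by exists N => n /NP; rewrite /side /mesh mulr1 ltr_pM2l.
Qed.

Lemma mesh_powR m t : mesh m `^ t = 2 `^ (- (t * m%:R)).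
Proof. by rewrite /mesh -powR_invn // -powRrM mulNr mulrC. Qed.

Lemma mesh_bracket (r : R) : 0 < r -> r <= 1 ->
  exists k, mesh k.+1 < r /\ r <= mesh k.
Proof.
move=> r0 r1; have ex : exists k, mesh k.+1 < r.
  by have [N NP] := mesh_small r0; exists N; apply: NP.
case: (ex_minnP ex) => -[|k] kr kmin; first by exists 0%N; rewrite /mesh expr0 invr1.
by exists k.+1; split => //; rewrite leNgt; apply/negP => /kmin; rewrite ltnn.
Qed.

Definition separated m l := pairwise (fun x y => mesh m <= `|x - y|) l.

Lemma separatedP m l x0 i j : separated m l -> (i < size l)%N -> (j < size l)%N ->
  i != j -> mesh m <= `|nth x0 l i - nth x0 l j|.
Proof.
move=> /(pairwiseP x0) sep il jl; rewrite neq_ltn => /orP[ij|ij]; first exact: sep.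
by rewrite distrC; apply: sep.
Qed.

Lemma uniq_pairwise (T : eqType) (r : rel T) (l : seq T) : uniq l ->
  {in l &, forall x y, x != y -> r x y} -> pairwise r l.
Proof.
elim: l => [//|x l IH] /= /andP[xl lu] h; apply/andP; split.
  apply/allP => y yl; apply: h; rewrite ?inE ?eqxx ?yl ?orbT //.
  by apply: contraNneq xl => ->.
by apply: IH => // y z yl zl; apply: h; rewrite inE ?yl ?zl orbT.
Qed.

(** A form of upper box dimension at most [b] in which the counts are bounded
without an error term. Its countably stable version [sigma_sparse] determines
the packing dimension. *)
Definition sparse b S := exists K, forall m l, (K <= m)%N -> separated m l ->
  (forall x, x \in l -> S x) -> (size l)%:R <= 2 `^ (b * m%:R) :> R.

Definition sigma_sparse b S := exists2 G : nat -> set (R * R),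
  S `<=` \bigcup_i G i & forall i, sparse b (G i).

Lemma two_powR_le (a b : R) : a <= b -> (2 : R) `^ a <= 2 `^ b.
Proof. by move=> ab; apply: ler_powR; rewrite // ler1n. Qed.

Lemma lim_at_right0_nondecreasing (f : R -> \bar R) :
  (forall x y, 0 < x -> x <= y -> (f x <= f y)%E) ->
  lim (f d @[d --> 0^'+]) = ereal_inf [set f d | d in [set d | 0 < d]].
Proof.
move=> fmono; apply/cvg_lim; first exact: ereal_hausdorff.
have -> : [set f d | d in [set d : R | 0 < d]] =
    [set f d | d in [set` Interval (BRight 0) (BInfty R false)]].
  congr (image _ _); apply/seteqP; split => x /=; rewrite in_itv /= andbT //.
apply: nondecreasing_at_right_cvge => // x y.
by rewrite in_itv /= andbT => x0 _; exact: fmono.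
Qed.

Lemma packing_premeasureE s F : packing_premeasure s F =
  ereal_inf [set packing_pre s d F | d in [set d | 0 < d]].
Proof.
apply: lim_at_right0_nondecreasing => x y x0 xy.
apply: ereal_sup_le => _ [I [c [r [cr triv ->]]]]; exists I, c, r; split => //.
by move=> i /cr[Fc /andP[r0 rx]]; rewrite r0 (le_trans rx).
Qed.

Lemma packing_pre_ge0 s d F : (0 <= packing_pre s d F)%E.
Proof.
apply: ereal_sup_ubound; exists set0, (fun=> 0), (fun=> 0); split => //.
by rewrite esum_set0.
Qed.

Lemma packing_premeasure_ge0 s F : (0 <= packing_premeasure s F)%E.
Proof.
rewrite packing_premeasureE; apply: le_ereal_inf_tmp => _ [d _ <-].
exact: packing_pre_ge0.
Qed.

Lemma diam_euclid_ball_ge (c : R * R) (r : R) : 0 <= r ->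
  (r%:E <= diam (euclid_ball c r))%E.
Proof.
move=> r0; have dcr : euclid_dist c (c.1 + r, c.2) = r.
  rewrite /euclid_dist /= subrr expr0n /= addr0 opprD addrA subrr add0r sqrrN.
  by rewrite sqrtr_sqr ger0_norm.
rewrite -{1}dcr; apply: diam_ge; rewrite /euclid_ball /= ?dcr //.
by rewrite /euclid_dist !subrr expr0n /= addr0 sqrtr0.
Qed.

Lemma diam_euclid_ball_le (c : R * R) (r : R) : 0 <= r ->
  (diam (euclid_ball c r) <= (4 * r)%:E)%E.
Proof.
move=> r0; apply: diam_le => [|x y]; first by rewrite mulr_ge0.
rewrite /euclid_ball /= => xr yr; apply: le_trans (euclid_le_norm _ _) _.
have -> : x - y = (c - y) - (c - x) by rewrite opprB [RHS]addrC addrA subrK.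
have := ler_normB (c - y) (c - x).
have := norm_le_euclid c x; have := norm_le_euclid c y; lra.
Qed.

(** Balls of radius [mesh m / 3] around a separated family are disjoint, so the
packing sum bounds the size of the family by a constant times [mesh m `^ (- t)]. *)
Lemma sparse_of_packing_pre t d g S : 0 <= t -> t < g -> 0 < d ->
  (packing_pre t d S < 1)%E -> sparse g S.
Proof.
move=> t0 tg d0 pre1; have [N NP] := mesh_small d0.
have [K KP] : exists K, forall m, (K <= m)%N -> 2 * t <= (g - t) * m%:R.
  have gt0 : 0 < g - t by rewrite subr_gt0.
  exists (Num.truncn (2 * t / (g - t))).+1 => m Km.
  rewrite [leRHS]mulrC -ler_pdivrMr //; apply: le_trans (ltW (truncnS_gt _)) _.
  by rewrite ler_nat.
exists (maxn N K) => m l; rewrite geq_max => /andP[Nm Km] lsep lS.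
pose r := mesh m / 3; have r0 : 0 < r by rewrite divr_gt0 // mesh_gt0.
have pre_ge : ((\sum_(i < size l) r `^ t)%:E <= packing_pre t d S)%E.
  apply: (@le_trans _ _ (\esum_(i in `I_(size l))
     poweR (diam (euclid_ball (nth 0 l i) r)) t)); last first.
    apply: ereal_sup_ubound; exists `I_(size l), (fun i => nth 0 l i), (fun=> r).
    split => //.
      move=> i il; split; first by apply: lS; exact: mem_nth.
      rewrite r0 /=; have := NP m Nm; have := mesh_gt0 m; rewrite /r; lra.
    move=> i j il jl [y []]; rewrite /euclid_ball /= => iy jy.
    apply/eqP; apply: contraT => ij; have := separatedP 0 lsep il jl ij.
    have -> : nth 0 l i - nth 0 l j = (nth 0 l i - y) - (nth 0 l j - y).
      by rewrite opprB addrA subrK.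
    have := ler_normB (nth 0 l i - y) (nth 0 l j - y).
    have := norm_le_euclid (nth 0 l i) y; have := norm_le_euclid (nth 0 l j) y.
    have := mesh_gt0 m; rewrite /r in iy jy; lra.
  rewrite esum_fset; [|exact: finite_II|by move=> *; exact: poweR_ge0].
  rewrite -fsbig_ord /= -sumEFin; apply: lee_sum => i _.
  rewrite -poweR_EFin; apply: poweR_le => //; first by rewrite lee_fin ltW.
  by apply: diam_euclid_ball_ge; exact: ltW.
have : \sum_(i < size l) r `^ t < 1 by rewrite -lte_fin; exact: le_lt_trans pre1.
rewrite sumr_const card_ord -(mulr_natl (r `^ t)).
have rt0 : 0 < r `^ t by exact: powR_gt0.
rewrite -ltr_pdivlMr // div1r => /ltW /le_trans; apply.
rewrite /r powRM ?(ltW (mesh_gt0 m)) ?invr_ge0 // mesh_powR.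
(* The constant 3 ^ t is at most 2 ^ (2 t), which the gap g - t absorbs for large m. *)
have t3 : (3^-1 : R) `^ t >= 2 `^ (- (2 * t)).
  have -> : (2 : R) `^ (- (2 * t)) = 4^-1 `^ t.
    have -> : (4^-1 : R) = 2 `^ (- 2%:R) by rewrite powR_invn // -natrX.
    by rewrite -powRrM mulNr.
  by apply: ge0_ler_powR; rewrite ?nnegrE // lef_pV2 ?posrE // ler_nat.
rewrite -[leRHS]invrK lef_pV2 ?posrE ?invr_gt0 ?mulr_gt0 ?powR_gt0 //.
rewrite -powRN.
apply: (@le_trans _ _ (2 `^ (- (t * m%:R)) * 2 `^ (- (2 * t)))); last first.
  by rewrite ler_wpM2l ?powR_ge0.
rewrite -powRD; last by rewrite pnatr_eq0 implybT.
by apply: two_powR_le; have := KP m Km; lra.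
Qed.

Lemma sigma_sparse_of_packing t g S : 0 <= t -> t < g ->
  packing_measure t S = 0%E -> sigma_sparse g S.
Proof.
move=> t0 tg S0; have : (packing_measure t S < 1)%E by rewrite S0.
move=> /ereal_inf_lt[_ [G SG ->] Glt]; exists G => // i.
have : (packing_premeasure t (G i) < 1)%E.
  apply: le_lt_trans Glt.
  apply: (@le_trans _ _ (\sum_(0 <= j < i.+1) packing_premeasure t (G j))%E).
    rewrite big_nat_recr //= leeDr // sume_ge0 // => j _.
    exact: packing_premeasure_ge0.
  by apply: nneseries_lim_ge => j _ _; exact: packing_premeasure_ge0.
rewrite packing_premeasureE => /ereal_inf_lt[_ [d /= d0 <-]].
exact: sparse_of_packing_pre.
Qed.

End PackingDimension.


Section PackingUpper.
Context {R : realType}.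
Implicit Types (S F G : set (R * R)) (s t d g b : R) (m k : nat).

Lemma esum_le_seq (I : set nat) (a : nat -> \bar R) (C : \bar R) :
  (forall J : seq nat, uniq J -> (forall i, i \in J -> I i) ->
    (\sum_(i <- J) a i <= C)%E) ->
  (\esum_(i in I) a i <= C)%E.
Proof.
move=> h; apply: ge_ereal_sup => _ [X [Xfin XI] <-].
rewrite fsbig_finite //; apply: h; first exact: finmap.fset_uniq.
by move=> i; rewrite in_fset_set // inE => /XI.
Qed.

Lemma sum_by_level (J : seq nat) (lev : nat -> nat) (f : nat -> R) (L : nat) :
  (forall i, i \in J -> (lev i < L)%N) ->
  \sum_(i <- J) f (lev i) =
    \sum_(0 <= k < L) (size [seq i <- J | lev i == k])%:R * f k.
Proof.
move=> levL.
transitivity (\sum_(i <- J) \sum_(0 <= k < L) (if lev i == k then f k else 0)).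
  rewrite big_seq [RHS]big_seq; apply: eq_bigr => i /levL iL.
  by rewrite -big_mkcond /= big_mkord (big_pred1 (Ordinal iL)).
rewrite exchange_big /=; apply: eq_bigr => k _.
rewrite -big_mkcond /= -big_filter big_const_seq count_predT iter_addr addr0.
by rewrite mulr_natl.
Qed.

Lemma geometric_tail (q : R) (N L : nat) : 0 < q -> q < 1 -> 
  \sum_(N <= k < L) q ^+ k <= q ^+ N / (1 - q).
Proof.
move=> q0 q1; have q1' : 0 < 1 - q by rewrite subr_gt0.
have [LN|NL] := leqP L N; first by rewrite big_geq // divr_ge0 ?exprn_ge0 ?ltW.
rewrite ler_pdivlMr // -(subnKC (ltnW NL)).
suff -> : forall n, (\sum_(N <= k < N + n) q ^+ k) * (1 - q) = q ^+ N - q ^+ (N + n).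
  by rewrite gerBl exprn_ge0 // ltW.
elim=> [|n IH]; first by rewrite addn0 big_geq // mul0r subrr.
by rewrite addnS big_nat_recr ?leq_addr //= mulrDl IH exprS; ring.
Qed.

(** The balls of a packing are grouped by the dyadic size of their radii. Within a
group the centres are separated, because no centre lies in another ball; so
the group of index [k] has at most [2 `^ (b * (k + 2))] members, and its sum is
a term of a geometric series of ratio [2 `^ (b - t)]. *)
Lemma packing_pre_small b t S e : b < t -> 0 <= t -> sparse b S -> 0 < e ->
  exists2 d, 0 < d & (packing_pre t d S <= e%:E)%E.
Proof.
move=> bt t0 [K KP] e0.
pose q : R := 2 `^ (b - t); have q0 : 0 < q by exact: powR_gt0.
have q1 : q < 1.
  have -> : 1 = (2 : R) `^ 0 by rewrite powRr0.
  by rewrite /q /powR pnatr_eq0 /= ltr_expR ltr_pM2r ?ln_gt0 ?ltr1n //; lra.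
pose C : R := 4 `^ t * 2 `^ (2 * b) / (1 - q).
have C0 : 0 < C by rewrite divr_gt0 ?subr_gt0 // mulr_gt0 // powR_gt0.
have [N1 N1P] : exists N, forall n, (N <= n)%N -> q ^+ n < e / C.
  have qn : `|q| < 1 by rewrite ger0_norm // ltW.
  have /cvgrPdist_lt/(_ _ (divr_gt0 e0 C0))[N _ NP] := cvg_expr qn.
  by exists N => n /NP; rewrite sub0r normrN ger0_norm // exprn_ge0 // ltW.
pose N := maxn N1 K; exists (mesh N); first exact: mesh_gt0.
apply: ge_ereal_sup => _ [I [c [r [cr triv ->]]]].
have rP i : I i -> 0 < r i /\ r i <= mesh N by move=> /cr[_ /andP[]].
have lev i : exists k, I i -> [/\ (N <= k)%N, mesh k.+1 < r i & r i <= mesh k].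
  have [Ii|nI] := pselect (I i); last by exists 0%N.
  have [r0 rN] := rP i Ii; have [|k [k1 k2]] := mesh_bracket r0.
    by apply: le_trans rN _; apply: le_trans (mesh_nincr (leq0n N)) _; rewrite /mesh expr0 invr1.
  exists k => _; split => //; rewrite leqNgt; apply/negP => kN.
  by have := mesh_nincr (R := R) kN; rewrite leNgt (lt_le_trans k1).
have {lev} [lev levP] := choice lev.
apply: esum_le_seq => J Ju JI.
pose f k : R := 4 `^ t * 2 `^ (- (t * k%:R)).
apply: (@le_trans _ _ (\sum_(i <- J) f (lev i))%:E).
  rewrite -sumEFin big_seq [leRHS]big_seq; apply: lee_sum => i /JI Ii.
  have [_ _ h] := levP i Ii; have [r0 _] := rP i Ii.
  apply: (@le_trans _ _ (poweR (4 * r i)%:E t)).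
    by apply: poweR_le (diam_ge0 _) _ => //; apply: diam_euclid_ball_le; exact: ltW.
  rewrite poweR_EFin lee_fin powRM ?(ltW r0) // /f ler_wpM2l ?powR_ge0 //.
  by rewrite -mesh_powR ge0_ler_powR // nnegrE ltW // mesh_gt0.
rewrite lee_fin.
pose L := (\max_(i <- J) lev i).+1.
have levL i : i \in J -> (lev i < L)%N by move=> iJ; rewrite ltnS; apply: leq_bigmax_seq.
rewrite (sum_by_level _ levL).
have level_le k : (size [seq i <- J | lev i == k])%:R * f k <=
    if (N <= k)%N then 4 `^ t * 2 `^ (2 * b) * q ^+ k else 0.
  case: ifPn => Nk; last first.
    rewrite (_ : [seq i <- J | lev i == k] = [::]) ?mul0r //.
    apply/eqP; rewrite -[_ == _]negbK -has_filter; apply/hasPn => i /JI Ii.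
    by apply: contra Nk => /eqP <-; have [] := levP i Ii.
  have cnt : (size [seq i <- J | lev i == k])%:R <= (2 : R) `^ (b * k.+2%:R).
    rewrite -(size_map c); apply: KP.
    - by apply: leq_trans (leq_maxr N1 K) _; apply: leq_trans Nk _; rewrite leqW // leqnSn.
    - rewrite /separated pairwise_map; apply: uniq_pairwise; first exact: filter_uniq.
      move=> i j; rewrite !mem_filter => /andP[/eqP ik /JI Ii] /andP[/eqP jk /JI Ij] ij.
      (* Two levels are lost: one because r i > mesh k.+1 only, one in passing from the
      Euclidean distance to the norm. *)
      have cj : ~ euclid_ball (c i) (r i) (c j).
        move=> h; move/eqP: ij; apply; apply: triv => //; exists (c j); split => //.
        have [r0 _] := rP j Ij.
        by rewrite /euclid_ball /= /euclid_dist !subrr expr0n /= addr0 sqrtr0 ltW.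
      have [_ + _] := levP i Ii; rewrite ik meshS.
      move: cj; rewrite /euclid_ball /= => /negP; rewrite -ltNge.
      have := euclid_le_norm (c i) (c j); lra.
    - by move=> x /mapP[i + ->]; rewrite mem_filter => /andP[_ /JI /cr[]].
  apply: (@le_trans _ _ ((2 : R) `^ (b * k.+2%:R) * f k)).
    by rewrite ler_wpM2r // mulr_ge0 // powR_ge0.
  rewrite le_eqVlt; apply/orP; left; apply/eqP.
  rewrite /f mulrCA -[RHS]mulrA; congr (_ * _).
  rewrite -powR_mulrn ?(ltW q0) // /q -powRrM -!powRD ?pnatr_eq0 ?implybT //.
  by congr powR; rewrite -addn2 natrD; ring.
apply: (@le_trans _ _ (\sum_(N <= k < L) 4 `^ t * 2 `^ (2 * b) * q ^+ k)).
  apply: le_trans (ler_sum _ (fun k _ => level_le k)) _.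
  have [NL|LN] := leqP N L.
    rewrite (big_cat_nat (leq0n N) NL) /= big1_seq ?add0r.
      rewrite big_nat [leRHS]big_nat; apply: ler_sum => k /andP[Nk _]; by rewrite Nk.
    by move=> k; rewrite mem_index_iota /= => kN; rewrite leqNgt kN.
  rewrite [leRHS]big_geq ?(ltnW LN) // big_nat big1 // => k /andP[_ kL].
  by rewrite leqNgt (ltn_trans kL).
rewrite -mulr_sumr.
apply: le_trans (ler_wpM2l _ (geometric_tail N L q0 q1)) _.
  by rewrite mulr_ge0 // powR_ge0.
rewrite mulrCA mulrC -/C; have := N1P N (leq_maxl _ _).
by rewrite ltr_pdivlMr // mulrC => /ltW; rewrite mulrC.
Qed.

Lemma packing_measure_sigma_sparse b t S : b < t -> 0 <= t -> sigma_sparse b S ->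
  packing_measure t S = 0%E.
Proof.
move=> bt t0 [G SG Gs]; apply/eqP; rewrite eq_le; apply/andP; split; last first.
  apply: le_ereal_inf_tmp => _ [H _ ->]; apply: nneseries_ge0 => n _ _.
  exact: packing_premeasure_ge0.
apply: (@le_trans _ _ (\sum_(i <oo) packing_premeasure t (G i))%E).
  by apply: ereal_inf_lbound; exists G.
rewrite eseries0 // => i _ _; apply/eqP; rewrite eq_le packing_premeasure_ge0 andbT.
rewrite packing_premeasureE; apply/lee_addgt0Pr => e e0; rewrite add0e.
have [d d0] := packing_pre_small bt t0 (Gs i) e0; apply: le_trans.
by apply: ereal_inf_lbound; exists d.
Qed.

Lemma packing_dim_le b S : 0 <= b -> (forall t, b < t -> sigma_sparse t S) ->
  (packing_dim S <= b%:E)%E.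
Proof.
move=> b0 sp; apply/lee_addgt0Pr => e e0; rewrite -EFinD.
apply: ereal_inf_lbound; exists (b + e) => //; split; first by rewrite addr_ge0 // ltW.
have h : b + e / 2 < b + e by lra.
by apply: packing_measure_sigma_sparse h _ (sp _ _); lra.
Qed.

Lemma packing_dim_ge b S : (forall g, g < b -> ~ sigma_sparse g S) ->
  (b%:E <= packing_dim S)%E.
Proof.
move=> nsp; apply: le_ereal_inf_tmp => _ [t [t0 St] <-]; rewrite lee_fin leNgt.
apply/negP => tb; have tg : t < (t + b) / 2 by lra.
by apply: (nsp _ _ (sigma_sparse_of_packing t0 tg St)); lra.
Qed.

End PackingUpper.


(** * Compact subsets of prescribed packing dimension *)

Section Sparse.
Context {R : realType}.
Implicit Types (S F G : set (R * R)) (b e : R) (m k n N : nat) (l : seq (R * R)).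

Lemma separated_uniq m l : separated m l -> uniq l.
Proof.
elim: l => [//|x l IH] /= /andP[/allP xl /IH ->]; rewrite andbT.
by apply/negP => /xl; rewrite subrr normr0 leNgt mesh_gt0.
Qed.

Lemma separated_le m k l : (m <= k)%N -> separated m l -> separated k l.
Proof.
move=> mk; apply: sub_pairwise => x y; apply: le_trans; exact: mesh_nincr.
Qed.

Lemma sub_sigma_sparse b S F : S `<=` F -> sigma_sparse b F -> sigma_sparse b S.
Proof. by move=> SF [G FG Gs]; exists G => //; exact: subset_trans FG. Qed.

Lemma sparse_set0 b : sparse b set0.
Proof.
exists 0%N => m [|x l] _ _ h; first exact: powR_ge0.
by case: (h x (mem_head _ _)).
Qed.

Lemma sigma_sparse_mono b t S : b <= t -> sigma_sparse b S -> sigma_sparse t S.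
Proof.
move=> bt [G SG Gs]; exists G => // i; have [K KP] := Gs i.
exists K => m l Km ls lG; apply: le_trans (KP m l Km ls lG) _.
by apply: two_powR_le; rewrite ler_wpM2r.
Qed.

Lemma sparse_sigma b S : sparse b S -> sigma_sparse b S.
Proof. by move=> Ss; exists (fun=> S) => // p Sp; exists 0%N. Qed.

Lemma sigma_sparse_bigcup b (G : nat -> set (R * R)) :
  (forall i, sigma_sparse b (G i)) -> sigma_sparse b (\bigcup_i G i).
Proof.
move=> Gs; have /choice[H HP] : forall i, exists H : nat -> set (R * R),
    G i `<=` \bigcup_j H j /\ forall j, sparse b (H j).
  by move=> i; have [H GH Hs] := Gs i; exists H.
pose code n : nat * nat := odflt (0, 0)%N (unpickle n).
exists (fun n => H (code n).1 (code n).2).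
  move=> p [i _ /(proj1 (HP i))[j _ Hp]]; exists (pickle (i, j)) => //.
  by rewrite /code pickleK.
by move=> n; apply: (proj2 (HP _)).
Qed.

Lemma sigma_sparse_setU b S F : sigma_sparse b S -> sigma_sparse b F ->
  sigma_sparse b (S `|` F).
Proof.
move=> Ss Fs; apply: (@sub_sigma_sparse _ _ (\bigcup_i (if i == 0%N then S else F))).
  by move=> p [Sp|Fp]; [exists 0%N|exists 1%N].
by apply: sigma_sparse_bigcup => i; case: ifP.
Qed.

Lemma powR_eventually (C g b : R) : g < b ->
  exists K, forall m, (K <= m)%N -> C * 2 `^ (g * m%:R) <= 2 `^ (b * m%:R).
Proof.
move=> gb; have bg0 : 0 < b - g by rewrite subr_gt0.
have [C0|C0] := leP C 0.
  exists 0%N => m _; apply: (@le_trans _ _ 0); last exact: powR_ge0.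
  by rewrite mulr_le0_ge0 // powR_ge0.
have C'0 : 0 < (C^-1) `^ (b - g)^-1 by rewrite powR_gt0 // invr_gt0.
have [K KP] := mesh_small C'0.
exists K => m /KP /(gt0_ltr_powR bg0).
rewrite -powRrM mulVf ?gt_eqF // powRr1 ?invr_ge0 ?(ltW C0) // mesh_powR.
rewrite !nnegrE ?(ltW (mesh_gt0 _)) ?powR_ge0 // => /(_ isT isT) h.
have -> : b * m%:R = (b - g) * m%:R + g * m%:R by ring.
rewrite powRD ?pnatr_eq0 ?implybT // ler_wpM2r ?powR_ge0 //.
have p0 : 0 < (2 : R) `^ ((b - g) * m%:R) by exact: powR_gt0.
move: h; rewrite powRN ltf_pV2 ?posrE //; exact: ltW.
Qed.

(** Being rich says that no piece of [S] cut out by a small ball around one of its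
points satisfies [sparse b]. *)
Definition rich b S := forall p N, S p -> exists m l, [/\ (N <= m)%N, separated m l,
  (forall x, x \in l -> S x /\ `|x - p| <= mesh N) & 2 `^ (b * m%:R) < (size l)%:R].

(** The points with a square in which [F] is [sigma_sparse b] form a
[sigma_sparse b] set, since there are countably many squares. What remains is
not [sigma_sparse b] near any of its points. *)
Lemma rich_kernel b F : (exists2 M : R, 0 < M & forall p, F p -> `|p| <= M) ->
  ~ sigma_sparse b F -> exists S, [/\ S `<=` F, S !=set0 & rich b S].
Proof.
move=> [M M0 FM] Fns.
pose bad v := sigma_sparse b (F `&` square M v).
pose S := [set p | F p /\ forall v, square M v p -> ~ bad v].
have FS : sigma_sparse b (F `\` S).
  pose G n := if unpickle n is Some v then [set p | F p /\ square M v p /\ bad v]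
    else set0.
  apply: (@sub_sigma_sparse _ _ (\bigcup_n G n)).
    move=> p [Fp nSp]; have [v vp bv] : exists2 v, square M v p & bad v.
      apply: contrapT => no; apply: nSp; split => // v vp bv; apply: no.
      by exists v.
    by exists (pickle v) => //; rewrite /G pickleK.
  have s0 : sigma_sparse b set0 by apply: sparse_sigma; exact: sparse_set0.
  apply: sigma_sparse_bigcup => n; rewrite /G; case: unpickle => [v|//].
  have [bv|nbv] := pselect (bad v).
    by apply: sub_sigma_sparse bv => p [Fp [vp _]].
  by apply: sub_sigma_sparse s0 => p [_ [_ /nbv]].
exists S; split; first by move=> p [].
  apply: contrapT => S0; apply: Fns; apply: sub_sigma_sparse FS => p Fp; split => //.
  by move=> Sp; apply: S0; exists p.
move=> p N [Fp pv]; have [n nP] := side_small M0 (mesh_gt0 N).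
have [v vn vp] := square_level M0 n (square_root (FM p Fp)).
apply: contrapT => no; apply: (pv v vp).
apply: (@sub_sigma_sparse _ _ ((S `&` square M v) `|` (F `\` S))).
  by move=> x [Fx vx]; have [Sx|nSx] := pselect (S x); [left|right].
apply: sigma_sparse_setU => //; apply: sparse_sigma; exists N => m l Nm lsep lS.
rewrite leNgt; apply/negP => lbig; apply: no; exists m, l; split => // x /lS[Sx vx].
split => //; apply: le_trans (square_diam vx vp) _; rewrite ltW // nP //.
by rewrite vn.
Qed.

(** This is the Baire category argument in [E]: balls centred in [E] are nested so
that the [i]-th one avoids [G i], and a cluster point of their centres lies in
all of them. *)
Lemma compact_baire (E : set (R * R)) (G : nat -> set (R * R)) : compact E -> E !=set0 ->
  (forall i p e, E p -> 0 < e -> exists q r, [/\ E q, 0 < r &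
    forall y, `|y - q| <= r -> `|y - p| <= e /\ ~ G i y]) ->
  ~ E `<=` \bigcup_i G i.
Proof.
move=> Ec [p0 Ep0] step cov.
pose P (i : nat) (a c : (R * R) * R) := [/\ E c.1, 0 < c.2 &
  forall y, `|y - c.1| <= c.2 -> `|y - a.1| <= a.2 /\ ~ G i y].
have /choice[next nextP] : forall ia : nat * ((R * R) * R), exists c,
    E ia.2.1 -> 0 < ia.2.2 -> P ia.1 ia.2 c.
  move=> [i [p e]] /=; have [[Ep e0]|no] := pselect (E p /\ 0 < e).
    by have [q [r qr]] := step i p e Ep e0; exists (q, r).
  by exists (p, e) => Ep e0; case: no.
(* A default value is returned outside the domain of the choice, which s never leaves. *)
pose s := fix s n := if n is n'.+1 then next (n', s n') else (p0, 1).
have sE n : E (s n).1 /\ 0 < (s n).2.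
  elim: n => [|n [IH1 IH2]] /=; first by split => //=; exact: ltr01.
  by have [] := nextP (n, s n) IH1 IH2.
have sP n : P n (s n) (s n.+1).
  by have [h1 h2] := sE n; exact: nextP (n, s n) h1 h2.
have nest n k y : `|y - (s (n + k)%N).1| <= (s (n + k)%N).2 -> `|y - (s n).1| <= (s n).2.
  elim: k => [|k IH]; first by rewrite addn0.
  by rewrite addnS => h; apply: IH; have [_ _ /(_ y h)[]] := sP (n + k)%N.
have near n k : `|(s (n + k)%N).1 - (s n).1| <= (s n).2.
  by apply: (nest n k); rewrite subrr normr0 ltW //; have [] := sE (n + k)%N.
have [q Eq qc] := compact_cluster (p := fun n => (s n).1) Ec (fun n => proj1 (sE n)).
have [i _ Gq] := cov q Eq; have [_ _ /(_ q)[]] := sP i; last by move=> _; apply.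
apply/ler_addgt0Pr => e e0; have [n ni nq] := qc e i.+1 e0.
have := near i.+1 (n - i.+1)%N; rewrite subnKC // => h.
have -> : q - (s i.+1).1 = ((s n).1 - (s i.+1).1) - ((s n).1 - q).
  by rewrite opprB [RHS]addrC addrA subrK.
by apply: le_trans (ler_normB _ _) _; apply: lerD => //; exact: ltW.
Qed.

End Sparse.


Section PackingTree.
Context {R : realType} (b : R) (b_gt0 : 0 < b) (X : set (R * R)) (X_rich : rich b X).
Context (p0 : R * R) (Xp0 : X p0).
Implicit Types (l A B : seq (R * R)) (m k n N : nat).

(** As [n] varies, the 2-adic valuation of [n + 1] takes each value infinitely often;
so each point of the growing list [A] is the centre of infinitely many stages. *)
Definition centre A n : R * R := nth p0 A (logn 2 n.+1).

Lemma centre_frequent A0 a K : a \in A0 -> exists2 n, (K <= n)%N &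
  forall A, centre (A0 ++ A) n = a.
Proof.
move=> aA; pose i := index a A0; pose n := (2 ^ i * (2 * K).+1).-1.
have nE : n.+1 = (2 ^ i * (2 * K).+1)%N by rewrite prednK // muln_gt0 expn_gt0.
exists n => [|A].
  rewrite -ltnS nE; apply: leq_trans (leq_pmull _ _); last by rewrite expn_gt0.
  by rewrite ltnS leq_pmull.
rewrite /centre; have -> : logn 2 n.+1 = i.
  rewrite nE lognM ?expn_gt0 // pfactorK // lognE /= dvdn2 /= oddM /=.
  by rewrite addn0.
by rewrite nth_cat index_mem aA nth_index.
Qed.

(** One stage adds to [A] a separated family [B] near a single point of [A], and [m]
is the first scale beyond [N] at which so large a family exists. From the scale [N] on
the size of [A] is within the bound aimed at, and the minimality of [m] bounds
the separated families near the centre at the scales between [N] and [m]. *)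
Definition step_spec A n N0 N m B :=
  [/\ (N0 < N)%N, (size A)%:R <= (2 : R) `^ (b * N%:R), (N <= m)%N, separated m B &
    [/\ forall x, x \in B -> X x /\ `|x - centre A n| <= mesh N,
      (2 : R) `^ (b * m%:R) < (size B)%:R,
      (size B)%:R <= 2 * (2 : R) `^ (b * m%:R) &
      forall k l, (N <= k)%N -> (k < m)%N -> separated k l ->
        (forall x, x \in l -> X x /\ `|x - centre A n| <= mesh N) ->
        (size l)%:R <= (2 : R) `^ (b * k%:R)]].

Lemma step_exists A n N0 : (forall x, x \in A -> X x) ->
  exists N m B, step_spec A n N0 N m B.
Proof.
move=> AX; have Xd : X (centre A n).
  rewrite /centre; have [h|h] := leqP (size A) (logn 2 n.+1).
    by rewrite nth_default.
  by apply: AX; exact: mem_nth.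
have [K KP] := @powR_eventually R (size A)%:R 0 b b_gt0.
pose N := maxn N0.+1 K.
pose good m := (N <= m)%N && `[< exists l, [/\ separated m l,
  forall x, x \in l -> X x /\ `|x - centre A n| <= mesh N &
  (2 : R) `^ (b * m%:R) < (size l)%:R] >].
have ex : exists m, good m.
  have [m [l [Nm ls lX lbig]]] := X_rich N Xd; exists m; rewrite /good Nm /=.
  by apply/asboolP; exists l.
case: (ex_minnP ex) => m /andP[Nm /asboolP[l [lsep lX lbig]]] mmin.
pose x := (2 : R) `^ (b * m%:R).
have x1 : 1 <= x.
  have -> : 1 = (2 : R) `^ 0 by rewrite powRr0.
  by apply: two_powR_le; rewrite mulr_ge0 // ltW.
(* The family found at scale m may be too large; any trunc x + 1 of its members suffice. *)
have tl : (Num.truncn x < size l)%N by rewrite truncn_lt_nat // (le_trans ler01).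
have sB : size (take (Num.truncn x).+1 l) = (Num.truncn x).+1 by rewrite size_takel.
exists N, m, (take (Num.truncn x).+1 l); split => //.
- by rewrite leq_max leqnn.
- by have := KP N (leq_maxr _ _); rewrite mul0r powRr0 mulr1.
- by apply: (subseq_pairwise _ lsep); exact: take_subseq.
split.
- by move=> y /mem_take; exact: lX.
- by rewrite sB; exact: truncnS_gt.
- rewrite sB -addn1 natrD; have /andP[h _] := truncn_itv (le_trans ler01 x1).
  by rewrite -/x; lra.
move=> k l' Nk km lsep' lX'; rewrite leNgt; apply/negP => big.
have : good k by rewrite /good Nk; apply/asboolP; exists l'.
by move=> /mmin; rewrite leqNgt km.
Qed.

Lemma packing_stages : exists (A B : nat -> seq (R * R)) (N m : nat -> nat),
  [/\ A 0%N = [:: p0], forall n, A n.+1 = A n ++ B n, forall n, (N n < N n.+1)%N &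
    forall n, exists N0, step_spec (A n) n N0 (N n) (m n) (B n)].
Proof.
have /choice[f fP] : forall c : seq (R * R) * nat * nat,
    exists r : nat * nat * seq (R * R), (forall x, x \in c.1.1 -> X x) ->
      step_spec c.1.1 c.1.2 c.2 r.1.1 r.1.2 r.2.
  move=> [[A n] N0] /=; have [AX|no] := pselect (forall x, x \in A -> X x).
    by have [N [m [B h]]] := step_exists n N0 AX; exists (N, m, B).
  by exists (0, 0, [::])%N => /no.
pose s := fix s n : seq (R * R) * nat := if n is n'.+1 then
    let r := f ((s n').1, n', (s n').2) in ((s n').1 ++ r.2, r.1.1)
  else ([:: p0], 0%N).
pose r n := f ((s n).1, n, (s n).2).
have sX n : forall x, x \in (s n).1 -> X x.
  elim: n => [|n IH] x /=; first by rewrite inE => /eqP ->.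
  rewrite mem_cat => /orP[/IH //|].
  by have [_ _ _ _ [h _ _ _]] := fP ((s n).1, n, (s n).2) IH; move=> /h[].
have rP n : step_spec (s n).1 n (s n).2 (r n).1.1 (r n).1.2 (r n).2.
  exact: fP ((s n).1, n, (s n).2) (sX n).
exists (fun n => (s n).1), (fun n => (r n).2), (fun n => (r n).1.1), (fun n => (r n).1.2).
split => // n; last by exists (s n).2.
by have [] := rP n.+1.
Qed.

End PackingTree.

Section PackingSubset.
Context {R : realType} (b : R) (b_gt0 : 0 < b) (X : set (R * R)).
Context (p0 : R * R) (Xp0 : X p0).
Context (A B : nat -> seq (R * R)) (N m : nat -> nat).
Context (A0 : A 0%N = [:: p0]) (AS : forall n, A n.+1 = A n ++ B n).
Context (NS : forall n, (N n < N n.+1)%N).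
Context (stepP : forall n, exists N0, step_spec b X p0 (A n) n N0 (N n) (m n) (B n)).

Definition stages : set (R * R) := [set x | exists n, x \in A n].
Definition limit_set : set (R * R) := closure stages.

Lemma mesh_radius_ge n : (n <= N n)%N.
Proof. by elim: n => [//|n IH]; exact: leq_ltn_trans (NS n). Qed.

Lemma stages_sub : stages `<=` X.
Proof.
move=> x [n]; elim: n => [|n IH]; first by rewrite A0 inE => /eqP ->.
rewrite AS mem_cat => /orP[/IH //|].
by have [N0 [_ _ _ _ [h _ _ _]]] := stepP n; move=> /h[].
Qed.

Lemma stage_prefix n k : exists l, A (n + k)%N = A n ++ l.
Proof.
elim: k => [|k [l h]]; first by exists [::]; rewrite addn0 cats0.
by exists (l ++ B (n + k)%N); rewrite addnS AS h catA.
Qed.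

Lemma stage0_mem n : p0 \in A n.
Proof. by have [l] := stage_prefix 0 n; rewrite add0n A0 => ->; rewrite mem_head. Qed.

Lemma stage_le n k x : (n <= k)%N -> x \in A n -> x \in A k.
Proof.
by move=> /subnKC <-; have [l ->] := stage_prefix n (k - n); rewrite mem_cat => ->.
Qed.

Lemma centre_mem n : centre p0 (A n) n \in A n.
Proof.
rewrite /centre; have [h|h] := leqP (size (A n)) (logn 2 n.+1).
  by rewrite nth_default // stage0_mem.
exact: mem_nth.
Qed.

(** The radii of the stages from [n] on decrease at least like powers of 1 / 2, so
their sum is at most twice the first. *)
Lemma later_stage_near k n x : x \in A (n + k)%N ->
  exists2 a, a \in A n & `|x - a| <= 2 * mesh (N n).
Proof.
elim: k n x => [|k IH] n x.
  rewrite addn0 => xA; exists x => //; rewrite subrr normr0 mulr_ge0 //.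
  exact/ltW/mesh_gt0.
rewrite -addSnnS => /IH[a aA xa].
have Nle : 2 * mesh (N n.+1) <= (mesh (N n) : R) by rewrite [leRHS]meshS ler_pM2l // mesh_nincr.
move: aA; rewrite AS mem_cat => /orP[aA|aB].
  by exists a => //; have := @mesh_gt0 R (N n); lra.
exists (centre p0 (A n) n); first exact: centre_mem.
have [N0 [_ _ _ _ [h _ _ _]]] := stepP n; have [_ ac] := h a aB.
have -> : x - centre p0 (A n) n = (x - a) + (a - centre p0 (A n) n) by rewrite addrA subrK.
by apply: le_trans (ler_normD _ _) _; lra.
Qed.

Lemma limit_set_near n x : limit_set x -> exists a, a \in A n /\ `|x - a| <= 3 * mesh (N n).
Proof.
move=> xE; have [y [[k yA] yx]] : stages `&` [set y | `|y - x| < mesh (N n)] !=set0.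
  by apply: xE; apply/nbhs_plane; exists (mesh (N n)) => //; exact: mesh_gt0.
have yA' : y \in A (n + k)%N by apply: stage_le yA; rewrite leq_addl.
have [a aA ya] := later_stage_near yA'; exists a; split => //.
have -> : x - a = (y - a) - (y - x) by rewrite opprB [RHS]addrC addrA subrK.
by apply: le_trans (ler_normB _ _) _; move: yx => /=; lra.
Qed.

Lemma separated_perturb (near : R * R -> R * R) k (d : R) l :
  2 * d <= mesh k.+1 -> separated k l ->
  (forall x, x \in l -> `|x - near x| <= d) -> separated k.+1 (map near l).
Proof.
move=> dk ls ln; rewrite /separated pairwise_map.
rewrite /separated in ls; elim: l ls ln => [//|x l IH] /= /andP[/allP xl ls] ln.
apply/andP; split; last by apply: IH => // y yl; apply: ln; rewrite inE yl orbT.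
apply/allP => y yl; have := xl y yl; rewrite meshS.
have := ln x (mem_head _ _); have := ln y _; rewrite inE yl orbT => /(_ isT).
have -> : x - y = ((x - near x) - (y - near y)) + (near x - near y).
  by rewrite opprB [RHS]addrAC !addrA !subrK.
have := ler_normD (x - near x - (y - near y)) (near x - near y).
have := ler_normB (x - near x) (y - near y); rewrite /=; lra.
Qed.

(** At scale [k] only the first stage [n] with [N n >= k + 4] is visible: the
limit set is so close to [A n] that a separated family can be moved into it,
at the cost of one level. In [A n], the part [A n.-1] is small because
[N n.-1 <= k + 3], and the part [B n.-1] is controlled by the minimality of
[m n.-1] below that scale and by its size above it. *)
Lemma limit_set_count k l : separated k l -> (forall x, x \in l -> limit_set x) ->
  (size l)%:R <= 3 * (2 : R) `^ (b * (k + 3)%:R).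
Proof.
move=> ls lE; set z := 2 `^ _.
have z1 : 1 <= z.
  have -> : 1 = (2 : R) `^ 0 by rewrite powRr0.
  by apply: two_powR_le; rewrite mulr_ge0 // ltW.
have ex : exists n, (k + 4 <= N n)%N by exists (k + 4)%N; exact: mesh_radius_ge.
case: (ex_minnP ex) => n kn nmin.
have /choice[near nearP] : forall x, exists a,
    limit_set x -> a \in A n /\ `|x - a| <= 3 * mesh (N n).
  move=> x; have [xE|nE] := pselect (limit_set x); last by exists 0.
  by have [a h] := limit_set_near n xE; exists a.
have ls' : separated k.+1 (map near l).
  apply: (@separated_perturb near k (3 * mesh (N n))) => //.
    have := @mesh_nincr R _ _ kn; rewrite !addnS addn0.
    have := @meshS R k.+1; have := @meshS R k.+2; have := @meshS R k.+3.
    have := @mesh_gt0 R k.+4; lra.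
  by move=> x /lE /nearP[].
have lu := separated_uniq ls'.
have lA x : x \in map near l -> x \in A n by move=> /mapP[y /lE /nearP[h _] ->].
rewrite -(size_map near); set l' := map near l in ls' lu lA *.
case: n nmin lA kn nearP => [|n] nmin lA _ _.
  apply: (@le_trans _ _ 1); last lra.
  rewrite (_ : 1 = (size (A 0%N))%:R :> R) ?A0 // ler_nat.
  by apply: uniq_leq_size => // x /lA; rewrite A0.
have Nk : (N n <= k + 3)%N.
  rewrite leqNgt; apply/negP; rewrite -ltnS -addnS => /nmin.
  by rewrite ltnn.
have [N0 [_ An Nm Bs [BX _ Bsize Bmin]]] := stepP n.
have zN : 2 `^ (b * (N n)%:R) <= z.
  by apply: two_powR_le; rewrite ler_pM2l // ler_nat.
rewrite -(count_predC (mem (A n)) l') natrD -!size_filter.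
have h1 : (size [seq x <- l' | x \in A n])%:R <= z.
  apply: le_trans zN; apply: le_trans An; rewrite ler_nat.
  by apply: uniq_leq_size => [|x]; rewrite ?filter_uniq // mem_filter => /andP[].
suff h2 : (size [seq x <- l' | x \notin A n])%:R <= 2 * z.
  by apply: le_trans (lerD h1 h2) _; lra.
have l2B x : x \in [seq x <- l' | x \notin A n] -> x \in B n.
  by rewrite mem_filter => /andP[xA /lA]; rewrite AS mem_cat (negbTE xA).
have [mk|km] := leqP (m n) (k + 3).
  apply: (@le_trans _ _ (size (B n))%:R).
    by rewrite ler_nat; apply: uniq_leq_size => //; exact: filter_uniq.
  apply: le_trans Bsize _; rewrite ler_pM2l //; apply: two_powR_le.
  by rewrite ler_pM2l // ler_nat.
apply: (@le_trans _ _ z); last lra.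
apply: Bmin => //; last by move=> x /l2B /BX.
have : separated (k + 3) l' by apply: separated_le ls'; rewrite !addnS addn0 ltnS leqW // leqnSn.
by move=> /subseq_pairwise; apply; exact: filter_subseq.
Qed.

Lemma limit_set_sparse t : b < t -> sparse t limit_set.
Proof.
move=> bt; have [K KP] := @powR_eventually R (3 * 2 `^ (3 * b)) b t bt.
exists K => k l Kk ls lE; apply: le_trans (limit_set_count ls lE) _.
apply: le_trans (KP k Kk); rewrite le_eqVlt; apply/orP; left; apply/eqP.
rewrite -mulrA; congr (_ * _); rewrite -powRD ?pnatr_eq0 ?implybT //.
by congr powR; rewrite natrD; ring.
Qed.

(** Near any point of the limit set there are stages, with arbitrarily large [m n],
that add more than [2 `^ (b * m n)] points at mutual distance [mesh (m n)]. A
[sparse g] set with [g < b] cannot be dense near all of them. *)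
Lemma limit_set_step (G : set (R * R)) g p e : g < b -> sparse g G -> limit_set p -> 0 < e ->
  exists q r, [/\ limit_set q, 0 < r &
    forall y, `|y - q| <= r -> `|y - p| <= e /\ ~ G y].
Proof.
move=> gb [K KP] Ep e0; apply: contrapT => no.
have dense q (d : R) : limit_set q -> `|q - p| <= e / 2 -> 0 < d ->
    exists y, G y /\ `|q - y| <= d.
  move=> Eq qp d0; apply: contrapT => none; apply: no.
  exists q, (Num.min d (e / 2)); split => //; first by rewrite lt_min d0 divr_gt0.
  move=> y; rewrite le_min => /andP[yd ye]; split.
    have -> : y - p = (y - q) + (q - p) by rewrite addrA subrK.
    by apply: le_trans (ler_normD _ _) _; lra.
  by move=> Gy; apply: none; exists y; rewrite distrC.
have e4 : 0 < e / 4 by rewrite divr_gt0.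
have [a [[n0 aA] /= ap]] : stages `&` [set y | `|y - p| < e / 4] !=set0.
  by apply: Ep; apply/nbhs_plane; exists (e / 4).
have [K1 K1P] := @powR_eventually R (2 `^ g) g b gb.
have [K2 K2P] := mesh_small e4.
have [n nK nc] := centre_frequent p0 (maxn n0 (maxn K (maxn K1 K2))) aA.
move: nK; rewrite !geq_max => /and4P[n0n Kn K1n K2n].
have [l Al] := stage_prefix n0 (n - n0); rewrite subnKC // in Al.
have ca : centre p0 (A n) n = a by rewrite Al nc.
have [N0 [_ _ Nm Bs [BX Bbig _ _]]] := stepP n.
have nm : (n <= m n)%N by apply: leq_trans Nm; exact: mesh_radius_ge.
have BE x : x \in B n -> limit_set x /\ `|x - p| <= e / 2.
  move=> xB; split.
    by apply: subset_closure; exists n.+1; rewrite AS mem_cat xB orbT.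
  have [_] := BX x xB; rewrite ca => xa.
  have /K2P : (K2 <= N n)%N by apply: leq_trans K2n _; exact: mesh_radius_ge.
  have -> : x - p = (x - a) + (a - p) by rewrite addrA subrK.
  by move=> h; apply: le_trans (ler_normD _ _) _; lra.
have /choice[near nearP] : forall x, exists y, x \in B n ->
    G y /\ `|x - y| <= mesh (m n).+2.
  move=> x; have [xB|nB] := boolP (x \in B n); last by exists 0.
  have [Ex xp] := BE x xB; have [y h] := dense x _ Ex xp (mesh_gt0 (m n).+2).
  by exists y.
have := @separated_perturb near (m n) (mesh (m n).+2) (B n).
rewrite -meshS lexx => /(_ isT Bs) sep.
have cnt : (size (map near (B n)))%:R <= (2 : R) `^ (g * (m n).+1%:R).
  apply: KP; first by apply: leq_trans Kn _; exact: leqW.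
    by apply: sep => x /nearP[].
  by move=> _ /mapP[x /nearP[Gy _] ->].
have := K1P (m n) (leq_trans K1n nm); rewrite leNgt => /negP; apply.
apply: lt_le_trans Bbig _; rewrite size_map in cnt; apply: le_trans cnt _.
rewrite le_eqVlt; apply/orP; left; apply/eqP.
rewrite -powRD ?pnatr_eq0 ?implybT //; congr powR; rewrite -addn1 natrD; ring.
Qed.

Lemma limit_set_not_sigma_sparse g : compact limit_set -> g < b ->
  ~ sigma_sparse g limit_set.
Proof.
move=> Ec gb [G EG Gs]; apply: (compact_baire Ec) EG.
  by exists p0; apply: subset_closure; exists 0%N; rewrite A0 mem_head.
by move=> i p e Ep e0; exact: limit_set_step gb (Gs i) Ep e0.
Qed.

End PackingSubset.

(** Inside the rich kernel of [F] a countable set is built in stages. Large families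
are inserted near each of its points at infinitely many scales, so that its
closure is nowhere [sigma_sparse g] for [g < b]; the scales are so far apart
that the number of visible points stays of order [2 `^ (b * k)] at each scale
[k]. *)
Lemma compact_subset_packing {R : realType} (F : set (R * R)) (b : R) :
  compact F -> 0 < b -> ~ sigma_sparse b F ->
  exists E, [/\ compact E, E `<=` F & packing_dim E = b%:E].
Proof.
move=> Fc b0 Fns; have Fcl : closed F by apply: compact_closed Fc; exact: norm_hausdorff.
have [X [XF [p0 Xp0] Xr]] := rich_kernel (compact_plane_bound Fc) Fns.
have [A [B [N [m [A0 AS NS stepP]]]]] := packing_stages b0 Xr Xp0.
have EF : limit_set A `<=` F.
  rewrite /limit_set (closure_id F).1 //; apply: closureS.
  by apply: subset_trans XF; exact: (stages_sub Xp0 A0 AS stepP).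
have Ec : compact (limit_set A).
  by apply: subclosed_compact Fc EF; exact: closed_closure.
exists (limit_set A); split => //; apply/eqP; rewrite eq_le; apply/andP; split.
  apply: packing_dim_le; first exact: ltW.
  by move=> t bt; apply: sparse_sigma; exact: (limit_set_sparse b0 A0 AS NS stepP).
apply: packing_dim_ge => g gb.
exact: (limit_set_not_sigma_sparse A0 AS NS stepP).
Qed.


(** * Graphs *)

Section Graph.
Context {R : realType} (f : R -> R).

Lemma compact_graph (K : set R) : {within K, continuous f} -> compact K ->
  compact (graph_over f K).
Proof.
move=> fK; apply: continuous_compact => x.
have idK : {within K, continuous (@idfun R)}.
  by apply: continuous_subspaceT => y; exact: cvg_id.
exact: cvg_pair (idK x) (fK x).
Qed.

Lemma graph_over_fst (K : set R) (E : set (R * R)) : E `<=` graph_over f K ->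
  graph_over f (fst @` E) = E /\ fst @` E `<=` K.
Proof.
move=> EK; split.
  apply/seteqP; split => [_ [_ [p Ep <-] <-]|p Ep].
    by have [x Kx xp] := EK p Ep; rewrite -xp /= xp.
  have [x Kx xp] := EK p Ep; exists x => //; exists p => //.
  by rewrite -xp.
by move=> _ [p /EK[x Kx <-] <-].
Qed.

Lemma compact_graph_subset (P : set (R * R) -> Prop) (K : set R) :
  (exists E, [/\ compact E, E `<=` graph_over f K & P E]) ->
  exists K', [/\ compact K', K' `<=` K & P (graph_over f K')].
Proof.
move=> [E [Ec EK PE]]; have [gE sE] := graph_over_fst EK.
exists (fst @` E); split; rewrite ?gE //.
apply: continuous_compact Ec; apply: continuous_subspaceT => p; exact: cvg_fst.
Qed.

End Graph.

Lemma hausdorff_measure_set0 (R : realType) s :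
  hausdorff_measure s (set0 : set (R * R)) = 0%E.
Proof.
rewrite hausdorff_measureE; apply/eqP; rewrite eq_le; apply/andP; split.
  apply: ge_ereal_sup => _ [d _ <-]; apply: ereal_inf_lbound.
  by exists set0, (fun=> set0); split => //; rewrite esum_set0.
apply: le_trans (hausdorff_pre_ge0 s 1 set0) _.
by apply: ereal_sup_ubound; exists 1 => //=.
Qed.

Lemma hausdorff_dim_ge0 (R : realType) (F : set (R * R)) : (0 <= hausdorff_dim F)%E.
Proof. by apply: le_ereal_inf_tmp => _ [t [t0 _] <-]; rewrite lee_fin. Qed.

Lemma packing_dim_ge0 (R : realType) (F : set (R * R)) : (0 <= packing_dim F)%E.
Proof. by apply: le_ereal_inf_tmp => _ [t [t0 _] <-]; rewrite lee_fin. Qed.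

Lemma hausdorff_dim_set0 (R : realType) : hausdorff_dim (set0 : set (R * R)) = 0%E.
Proof.
apply/eqP; rewrite eq_le hausdorff_dim_ge0 andbT.
by apply: hausdorff_dim_le => //; exact: hausdorff_measure_set0.
Qed.

Lemma packing_dim_set0 (R : realType) : packing_dim (set0 : set (R * R)) = 0%E.
Proof.
apply/eqP; rewrite eq_le packing_dim_ge0 andbT; apply: packing_dim_le => // t _.
exact: sparse_sigma (sparse_set0 _).
Qed.

(** The end points are immediate; between them it is enough to work in the plane,
as a subset of a graph is the graph over its projection. *)
Lemma graph_intermediate (R : realType) (f : R -> R) (K : set R)
    (dim : set (R * R) -> \bar R) (beta : R) :
  compact K -> dim set0 = 0%E -> 0 <= beta -> (beta%:E <= dim (graph_over f K))%E ->
  (0 < beta -> (beta%:E < dim (graph_over f K))%E ->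
    exists E, [/\ compact E, E `<=` graph_over f K & dim E = beta%:E]) ->
  exists K', [/\ compact K', K' `<=` K & dim (graph_over f K') = beta%:E].
Proof.
move=> Kc dim0; rewrite le_eqVlt => /orP[/eqP <- _ _|b0].
  exists set0; split; [exact: compact0|exact: sub0set|].
  by rewrite /graph_over image_set0.
rewrite le_eqVlt => /orP[/eqP ->|bd]; first by move=> _; exists K; split => //; exact: subset_refl.
by move=> /(_ b0 bd) /compact_graph_subset.
Qed.

Theorem theorem4p4 (R : realType) (f : R -> R)
    (hf : {within `[0, 1], continuous f}) :
  (forall beta : R, 0 <= beta ->
     (beta%:E <= hausdorff_dim (graph_over f `[0%R, 1%R]))%E ->
     exists K : set R,
       [/\ compact K, K `<=` `[0, 1] &
           hausdorff_dim (graph_over f K) = beta%:E]) /\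
  (forall beta : R, 0 <= beta ->
     (beta%:E <= packing_dim (graph_over f `[0%R, 1%R]))%E ->
     exists K : set R,
       [/\ compact K, K `<=` `[0, 1] &
           packing_dim (graph_over f K) = beta%:E]).
Proof.
have Ic : compact `[0%R : R, 1%R] by exact: segment_compact.
have Gc := compact_graph hf Ic.
split=> beta b0 bdim.
  apply: graph_intermediate bdim _ => //; first exact: hausdorff_dim_set0.
  move=> b1 blt; apply: compact_subset_hausdorff => //.
  apply: contraTneq blt => H0; rewrite -leNgt.
  by apply: hausdorff_dim_le => //; exact: ltW.
apply: graph_intermediate bdim _ => //; first exact: packing_dim_set0.
move=> b1 blt; apply: compact_subset_packing => // bs.
move: blt; apply/negP; rewrite -leNgt; apply: packing_dim_le => // t bt.
exact: sigma_sparse_mono (ltW bt) bs.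
Qed.
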